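(* Let $\mathbb{G}$ be a stratified Lie group of homogeneous dimension $Q$. Let $0<\beta<1$, $0<\alpha<Q$, $0<\alpha+\beta<Q$, and let $b$ be a locally integrable function on $\mathbb{G}$. Then the following assertions are equivalent: (A.1) $b\in\Lambda_{\beta}(\mathbb{G})$ and $b\ge 0$. (A.2) $[b,M_{\alpha}]$ is bounded from $L^{p}(\mathbb{G})$ to $L^{q}(\mathbb{G})$ for all $p$ and $q$ satisfying $1<p<\frac{Q}{\alpha+\beta}$ and $\frac1q=\frac1p-\frac{\alpha+\beta}{Q}$. (A.3) $[b,M_{\alpha}]$ is bounded from $L^{p}(\mathbb{G})$ to $L^{q}(\mathbb{G})$ for some $p$ and $q$ such that $1<p<\frac{Q}{\alpha+\beta}$ and $\frac1q=\frac1p-\frac{\alpha+\beta}{Q}$. (A.4) There exists $s\in[1,\infty)$ such that $$\sup_{B}\frac{1}{|B|^{\beta/Q}}\left(\frac{1}{|B|}\int_{B}\left|b(x)-|B|^{-\alpha/Q}M_{\alpha,B}(b)(x)\right|^{s}dx\right)^{1/s}<\infty,$$ where the supremum is taken over all $\mathbb{G}$-balls $B\subset\mathbb{G}$. (A.5) For all $s\in[1,\infty)$, $$\sup_{B}\frac{1}{|B|^{\beta/Q}}\left(\frac{1}{|B|}\int_{B}\left|b(x)-|B|^{-\alpha/Q}M_{\alpha,B}(b)(x)\right|^{s}dx\right)^{1/s}<\infty,$$ where the supremum is taken over all $\mathbb{G}$-balls $B\subset\mathbb{G}$.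
   Context: Stratified Lie group: $\mathbb{G}$ is a finite-dimensional, connected and simply connected Lie group whose Lie algebra $\mathcal{G}$ has a vector space decomposition $\mathcal{G}=V_1\oplus\cdots\oplus V_m$ with $[V_1,V_j]=V_{j+1}$ for $1\le j\le m-1$ and $[V_1,V_j]=0$ for $j\ge m$; $\mathcal{G}$ is nilpotent of step $m$. The dilations $\delta_r$ ($r>0$) are defined on $\mathcal{G}$ by $\delta_r(\sum_k X_k)=\sum_k r^kX_k$ for $X_k\in V_k$, and are transported to $\mathbb{G}$ by the exponential map (a diffeomorphism). The homogeneous dimension is $Q=\sum_{j=1}^m j\dim V_j$. Integration $dx$ and $|\cdot|$ refer to a fixed bi-invariant Haar measure on $\mathbb{G}$, and $L^p(\mathbb{G})$ is the usual Lebesgue space for it. The identity element is $e$. Fix a homogeneous norm $\rho:\mathbb{G}\to[0,\infty)$: a continuous function, $C^\infty$ away from $e$, with $\rho(x^{-1})=\rho(x)$, $\rho(\delta_t x)=t\rho(x)$ for $t>0$, $\rho(e)=0$, and $\rho(xy)\le c_0(\rho(x)+\rho(y))$ for some constant $c_0\ge1$. The $\mathbb{G}$-balls are $B(x,r)=\{y\in\mathbb{G}:\rho(y^{-1}x)<r\}$, $x\in\mathbb{G}$, $r>0$; there is a constant $c_1\in(0,\infty)$ with $|B(x,r)|=c_1r^Q$ for all $x$ and $r$. Functions are real-valued, and locally integrable functions that agree almost everywhere are identified. For $0<\beta<1$, $b\in\Lambda_\beta(\mathbb{G})$ means that there is $C>0$ with $|b(x)-b(y)|\le C(\rho(y^{-1}x))^\beta$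 for all $x,y\in\mathbb{G}$. For $0\le\alpha<Q$ and $f$ locally integrable, the fractional maximal function is $M_\alpha(f)(x)=\sup_{B\ni x}\frac{1}{|B|^{1-\alpha/Q}}\int_B|f(y)|\,dy$, the supremum being over all $\mathbb{G}$-balls $B\subset\mathbb{G}$ containing $x$. The nonlinear commutator is $[b,M_\alpha](f)(x)=b(x)M_\alpha(f)(x)-M_\alpha(bf)(x)$. For a fixed $\mathbb{G}$-ball $B^*$, $M_{\alpha,B^*}(f)(x)=\sup_{x\in B\subset B^*}\frac{1}{|B|^{1-\alpha/Q}}\int_B|f(y)|\,dy$, the supremum being over all $\mathbb{G}$-balls $B$ with $x\in B\subset B^*$. An operator $T$ is bounded from $L^p(\mathbb{G})$ to $L^q(\mathbb{G})$ if there is $C>0$ with $\|T f\|_{L^q(\mathbb{G})}\le C\|f\|_{L^p(\mathbb{G})}$ for all $f\in L^p(\mathbb{G})$ (no linearity is assumed). *)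

(* Defs.v *)
From HB Require Import structures.
From mathcomp Require Import all_boot all_order all_algebra.
From mathcomp Require Import all_classical all_reals all_analysis.

Set Implicit Arguments.
Unset Strict Implicit.
Unset Printing Implicit Defensive.

Import Order.TTheory GRing.Theory Num.Theory.
Import numFieldNormedType.Exports.

Local Open Scope classical_set_scope.
Local Open Scope ring_scope.

(* The smooth maps between finite-dimensional spaces, on an open set D: in
   finite dimension, f is C^(k+1) iff all its directional derivatives exist
   and are C^k. *)
Section smooth_maps.
Context {R : realType} {V W : normedModType R}.

Fixpoint Ck (k : nat) (D : set V) (f : V -> W) : Prop :=
  (forall x, D x -> {for x, continuous f}) /\
  if k is k'.+1 then
    forall v : V, (forall x, D x -> derivable f x v) /\
                  Ck k' D (fun x => 'D_v f x)
  else True.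

Definition smooth_on (D : set V) (f : V -> W) := forall k, Ck k D f.

End smooth_maps.

#[short(type="ptopGroupType")]
HB.structure Definition PTopGroup := {G of PointedTopological G & Group G}.

Section group_in_exponential_coordinates.
Context {R : realType} {n : nat} {G : ptopGroupType}.
Variables (expG : 'rV[R]_n -> G) (logG : G -> 'rV[R]_n).

(* Ad(g) Y = d/dt g exp(tY) g^-1 at t = 0. The derivative is computed in the
   chart logG, in which the tangent space at the identity is 'rV[R]_n. *)
Definition Ad (g : G) (Y : 'rV[R]_n) : 'rV[R]_n :=
  derive1 (fun t : R => logG (g * expG (t *: Y) * g^-1)%g) 0.

(* [X, Y] = d/ds Ad(exp(sX)) Y at s = 0. *)
Definition lie_bracket (X Y : 'rV[R]_n) : 'rV[R]_n :=
  derive1 (fun s : R => Ad (expG (s *: X)) Y) 0.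

(* [U1, U2] = W: the subspace W is the linear span of the brackets. *)
Definition bracket_spans (U1 U2 W : {vspace 'rV[R]_n}) :=
  (forall X Y, X \in U1 -> Y \in U2 -> lie_bracket X Y \in W) /\
  (forall W' : {vspace 'rV[R]_n},
    (forall X Y, X \in U1 -> Y \in U2 -> lie_bracket X Y \in W') ->
    (W <= W')%VS).

End group_in_exponential_coordinates.

(* The Lie algebra is R^n, for a choice of basis. The manifold structure of the
   group is the one that makes its exponential map a diffeomorphism onto the
   group: the fields sg_exp_cont and sg_log_cont say that the topology is the
   one of this manifold, sg_mul_smooth and sg_inv_smooth that the group is a Lie
   group, and sg_expD that t |-> exp(tX) is the one-parameter subgroup with
   velocity X. Connectedness and simple connectedness follow.
   The layer V_j is sg_layer j, and only 1 <= j <= sg_step is meaningful. *)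
Record stratifiedGroup (R : realType) := StratifiedGroup {
  sg_carrier :> ptopGroupType ;
  sg_dim : nat ;
  sg_step : nat ;
  sg_exp : 'rV[R]_sg_dim -> sg_carrier ;
  sg_log : sg_carrier -> 'rV[R]_sg_dim ;
  sg_layer : nat -> {vspace 'rV[R]_sg_dim} ;
  sg_expK : cancel sg_exp sg_log ;
  sg_logK : cancel sg_log sg_exp ;
  sg_exp_cont : continuous sg_exp ;
  sg_log_cont : continuous sg_log ;
  sg_mul_smooth : smooth_on setT
    (fun u : 'rV[R]_sg_dim * 'rV[R]_sg_dim =>
       sg_log (sg_exp u.1 * sg_exp u.2)%g) ;
  sg_inv_smooth : smooth_on setT
    (fun u : 'rV[R]_sg_dim => sg_log (sg_exp u)^-1%g) ;
  sg_expD : forall (s t : R) (X : 'rV[R]_sg_dim),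
    sg_exp ((s + t) *: X) = (sg_exp (s *: X) * sg_exp (t *: X))%g ;
  sg_step_gt0 : (0 < sg_step)%N ;
  sg_layer_sum : (\sum_(j < sg_step) sg_layer j.+1 = fullv)%VS ;
  sg_layer_direct : directv (\sum_(j < sg_step) sg_layer j.+1)%VS ;
  sg_layer_step : sg_layer sg_step != 0%VS ;
  sg_bracket : forall j, (1 <= j < sg_step)%N ->
    bracket_spans sg_exp sg_log (sg_layer 1) (sg_layer j) (sg_layer j.+1) ;
  sg_bracket_step : forall X Y,
    X \in sg_layer 1 -> Y \in sg_layer sg_step ->
    lie_bracket sg_exp sg_log X Y = 0
}.

(* A set of group elements is measurable when it is Borel. *)
Notation borelType G := (g_sigma_algebraType (@open G)).

Section stratified_group.
Context {R : realType} (G : stratifiedGroup R).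

Definition algebra_dilation (r : R) (X : 'rV[R]_(sg_dim G)) :
    'rV[R]_(sg_dim G) :=
  \sum_(j < sg_step G) r ^+ j.+1 *:
    sumv_pi (\sum_(i < sg_step G) sg_layer G i.+1)%VS j X.

Definition dilation (r : R) (x : G) : G :=
  sg_exp (algebra_dilation r (sg_log x)).

Definition hom_dim : nat := (\sum_(j < sg_step G) j.+1 * \dim (sg_layer G j.+1))%N.

Record homogeneous_norm (rho : G -> R) : Prop := HomogeneousNorm {
  hnorm_ge0 : forall x, 0 <= rho x ;
  hnorm_cont : continuous rho ;
  hnorm_smooth :
    smooth_on [set u : 'rV[R]_(sg_dim G) | u != 0]
      (fun u => rho (sg_exp u) : R^o) ;
  hnormV : forall x, rho x^-1%g = rho x ;
  hnorm_dilation : forall t x, 0 < t -> rho (dilation t x) = t * rho x ;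
  hnorm1 : rho 1%g = 0 ;
  hnormM : exists2 c0 : R, 1 <= c0 &
    forall x y, rho (x * y)%g <= c0 * (rho x + rho y)
}.

Record biinvariant_haar (mu : {measure set (borelType G) -> \bar R}) : Prop :=
  BiinvariantHaar {
  haar_left : forall (g : G) (A : set (borelType G)), measurable A ->
    mu [set (g * x)%g | x in (A : set G)] = mu A ;
  haar_right : forall (g : G) (A : set (borelType G)), measurable A ->
    mu [set (x * g)%g | x in (A : set G)] = mu A ;
  haar_compact : forall K : set G, compact K -> (mu K < +oo)%E ;
  haar_open : forall U : set G, open U -> U !=set0 -> (0 < mu U)%E
}.

Definition gball (rho : G -> R) (x : G) (r : R) : set G :=
  [set y | rho (y^-1 * x)%g < r].

Definition loc_integrable (mu : {measure set (borelType G) -> \bar R})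
    (f : G -> R) : Prop :=
  measurable_fun (setT : set (borelType G)) f /\
  forall K : set G, compact K -> (\int[mu]_(x in K) `|f x|%:E < +oo)%E.

Definition Lambda (rho : G -> R) (beta : R) (b : G -> R) : Prop :=
  exists2 C : R, 0 < C &
    forall x y, `|b x - b y| <= C * (rho (y^-1 * x)%g) `^ beta.

Section maximal_functions.
Variables (mu : {measure set (borelType G) -> \bar R}) (rho : G -> R).
Local Open Scope ereal_scope.

Definition frac_average (alpha : R) (f : G -> R) (c : G) (r : R) : \bar R :=
  (mu (gball rho c r) `^ (1 - alpha / (hom_dim%:R)))^-1 *
  \int[mu]_(y in gball rho c r) `|f y|%:E.

Definition frac_maximal (alpha : R) (f : G -> R) (x : G) : \bar R :=
  ereal_sup [set z | exists c r,
    [/\ (0 < r)%R, gball rho c r x & z = frac_average alpha f c r]].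

Definition frac_maximal_in (alpha : R) (B : set G) (f : G -> R) (x : G) :
    \bar R :=
  ereal_sup [set z | exists c r,
    [/\ (0 < r)%R, gball rho c r x, gball rho c r `<=` B
      & z = frac_average alpha f c r]].

(* The values may be infinite, or even of the form +oo - +oo, for which the
   library's value is -oo: the L^q norm takes this into account. *)
Definition max_commutator (b : G -> R) (alpha : R) (f : G -> R) (x : G) :
    \bar R :=
  (b x)%:E * frac_maximal alpha f x -
  frac_maximal alpha (fun y => b y * f y)%R x.

Definition bounded_Lp_Lq (T : (G -> R) -> G -> \bar R) (p q : R) : Prop :=
  exists2 C : R, (0 < C)%R &
    forall f : G -> R, measurable_fun (setT : set (borelType G)) f ->
      'N[mu]_p%:E[EFin \o f] < +oo ->
      'N[mu]_q%:E[T f] <= C%:E * 'N[mu]_p%:E[EFin \o f].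

Definition oscillation (b : G -> R) (alpha beta s : R) (c : G) (r : R) :
    \bar R :=
  let B := gball rho c r in
  let Q : R := hom_dim%:R in
  (mu B `^ (beta / Q))^-1 *
  ((mu B)^-1 *
   \int[mu]_(x in B)
     `| (b x)%:E - mu B `^ (- (alpha / Q)) * frac_maximal_in alpha B b x |
       `^ s) `^ s^-1.

Definition oscillation_bounded (b : G -> R) (alpha beta s : R) : Prop :=
  ereal_sup [set z | exists c r,
    (0 < r)%R /\ z = oscillation b alpha beta s c r] < +oo.

End maximal_functions.

End stratified_group.

(* Main.v *)
Require Import Defs.
From HB Require Import structures.
From mathcomp Require Import all_boot all_order all_algebra.
From mathcomp Require Import all_classical all_reals all_analysis.
From mathcomp Require Import measurable_realfun.
From mathcomp Require Import ring lra.

(** For a ball B write |b|_B and b_B for the means of |b| and b over B. The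
    deficit (|b|_B - b)^+ of b on B links all the assertions: each of them
    amounts to saying that its mean over a ball of radius r is O(r^beta).

    Suppose that b is nonnegative and in the class Lambda_beta. On a ball B of
    radius r that contains x, b differs from b(x) by O(r^beta), and r^beta is
    comparable to |B|^(beta/Q). So replacing b(y) by b(x) in an average of
    b f costs at most an average of order alpha + beta: wherever M_alpha f is
    finite, |[b, M_alpha] f| <= K M_(alpha+beta) f ([commutator_le]). The
    maximal function of order alpha + beta maps L^p to L^q
    ([frac_maximal_strong_type]), and the same estimate at order alpha shows
    that M_alpha f is finite almost everywhere; this gives
    [commutator_bounded]. Likewise |B|^(-alpha/Q) M_(alpha,B) b lies within
    O(r^beta) of b on B ([maximal_in_close]), which bounds the oscillation of
    every exponent.

    Conversely, the functions that the assertions compare with b are at least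
    |b|_B on B. For the oscillation, B itself is one of the balls in the
    supremum that defines M_(alpha,B) b. For the commutator, take the indicator
    function of B: its maximal function is |B|^(alpha/Q) on B
    ([frac_maximal_indic]), while that of b times it is at least
    |B|^(alpha/Q) |b|_B. In both cases the deficit is dominated pointwise by a
    quantity whose power mean is controlled.

    Suppose finally that the mean deficit is O(r^beta). Since b_B <= |b|_B and
    the mean of |b - b_B| is twice the mean of (b_B - b)^+, the mean oscillation
    of b is O(r^beta), which is Campanato's description of Lambda_beta: the
    means over balls shrinking to x converge, the limit b'(x) is a Lipschitz
    function, and the mean of |b - b'| over any ball of radius r is O(r^beta).
    Covering a fixed ball by balls of radius r tending to 0 yields b = b' almost
    everywhere. The deficit also bounds |b|_B - b_B, so b_B >= - O(r^beta),
    and in the limit b' >= 0 ([nonneg_Lambda_representative]).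

    The geometry enters through the volume |B(x,r)| = c1 r^Q, the
    quasi-triangle inequality and the relative compactness of balls
    ([gball_compact]). One covering lemma, [vitali_countable], compares the
    integrals of two densities over a union of balls; it serves both for the
    weak type estimate of the maximal function and for the last covering step. *)

Set Implicit Arguments.
Unset Strict Implicit.
Unset Printing Implicit Defensive.

Import Order.TTheory GRing.Theory Num.Theory.
Import numFieldNormedType.Exports.

Local Open Scope classical_set_scope.
Local Open Scope ring_scope.

(** * Elementary inequalities *)

Section inequalities.
Context {R : realType}.
Implicit Types (a d e k m t u v w : R).

Lemma dist_le u v k : `|u - v| <= k -> u <= v + k /\ v <= u + k.
Proof. by rewrite ler_norml => h; split; lra. Qed.

Lemma le_dist u v m k : u - k <= m -> m <= v -> v <= u + k -> `|u - v| <= k.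
Proof. by move=> *; rewrite ler_norml; lra. Qed.

Lemma dist_le_deficit a m t w :
  m <= a -> a - t <= w -> 0 <= w -> `|t - m| <= 2 * w - (m - t).
Proof. by move=> *; rewrite ler_norml; apply/andP; split; lra. Qed.

Lemma opp_le_of_mean a d e m t :
  m <= t + d -> a - m <= e -> 0 <= a -> - t <= d + e.
Proof. by move=> *; lra. Qed.

(** Lets the radius tend to 0 in the estimates by powers of a radius. *)
Lemma le0_of_le_powR (beta t F : R) : 0 < beta ->
  (forall s, 0 < s -> t <= F * s `^ beta) -> t <= 0.
Proof.
move=> beta_gt0 h; rewrite leNgt; apply/negP => t0.
have F0 : 0 < F.
  have := h 1 ltr01; rewrite powR1 mulr1; exact: lt_le_trans.
have s0 : 0 < (t / (2 * F)) `^ beta^-1 by rewrite powR_gt0// divr_gt0// mulr_gt0.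
have := h _ s0; rewrite -powRrM mulVf ?gt_eqF// powRr1; last first.
  by rewrite divr_ge0// ?mulr_ge0 ?ltW.
have -> : F * (t / (2 * F)) = t / 2 by field; rewrite gt_eqF.
by lra.
Qed.

Local Open Scope ereal_scope.

Lemma abse_sub_le (u v w : \bar R) : u \is a fin_num -> 0 <= v -> 0 <= w ->
  u <= v + w -> v <= u + w -> `|u - v| <= w.
Proof.
case: u => // u _; case: w => // [w|_ _ _ _]; last by rewrite leey.
case: v => [v| |//] v0 w0.
  rewrite -!EFinD !lee_fin => h1 h2; rewrite ler_norml; lra.
by rewrite -EFinD leye_eq.
Qed.

(** How the deficit is bounded by the quantities of the theorem; g may be
    infinite. *)
Lemma pos_part_le_abse (u t : R) (g : \bar R) : u%:E <= g ->
  (Num.max 0 (u - t))%:E <= `|t%:E - g|.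
Proof.
case: g => [g| |//]; last by move=> _; rewrite leey.
rewrite !lee_fin => ug; rewrite ge_max normr_ge0/=.
by rewrite distrC (le_trans _ (ler_norm _))// lerB.
Qed.

End inequalities.

(** * Two integral inequalities *)

Section integrals.
Context d (T : measurableType d) (R : realType).
Variable mu : {measure set T -> \bar R}.
Local Open Scope ereal_scope.

Lemma integral_setU_le (f : T -> \bar R) (B C : set T) : measurable_fun setT f ->
  (forall x, 0 <= f x) -> measurable B -> measurable C ->
  \int[mu]_(x in B `|` C) f x <= \int[mu]_(x in B) f x + \int[mu]_(x in C) f x.
Proof.
move=> mf f0 mB mC; have -> : B `|` C = B `|` (C `\` B).
  apply/seteqP; split => x [Bx|]; [by left| |by left|by case; right].
  by have [Bx|Bx] := pselect (B x); [left|right].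
rewrite ge0_integral_setU//=; last 3 first.
- exact: measurableD.
- exact: measurable_funS mf.
- by rewrite disj_set2E setDIK.
by apply: leeD => //; apply: ge0_subset_integral => //;
  [exact: measurableD|exact: measurable_funS mf].
Qed.

(** A substitute for Jensen's inequality that costs only the factor 2: a
    nonnegative g is at most L where g <= L and at most L^(1-s) g^s elsewhere. *)
Lemma integral_le_of_power (D : set T) (g : T -> R) (m s L : R) :
  measurable D -> mu D = m%:E -> measurable_fun D g -> (forall x, D x -> 0 <= g x)%R ->
  (1 <= s)%R -> (0 < L)%R ->
  \int[mu]_(x in D) (g x `^ s)%:E <= (L `^ s * m)%:E ->
  \int[mu]_(x in D) (g x)%:E <= (2 * L * m)%:E.
Proof.
move=> mD muD mg g0 s1 L0 h.
have mgs : measurable_fun D (fun x => (g x `^ s)%:E).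
  by apply/measurable_EFinP; exact: (measurableT_comp (measurable_powR _)).
have young x : D x -> (g x <= L + L `^ (1 - s) * g x `^ s)%R.
  move=> Dx; have [gL|Lg] := leP (g x) L.
    by rewrite (le_trans gL)// lerDl mulr_ge0 ?powR_ge0.
  rewrite (le_trans _ (_ : L `^ (1 - s) * g x `^ s <= _)%R) ?lerDr ?(ltW L0)//.
  have gx0 := g0 x Dx.
  rewrite -[in leRHS](@mulr_powRB1 _ (g x)) ?(lt_le_trans ltr01)// mulrCA.
  rewrite ler_peMr// -opprB powRN mulrC ler_pdivlMr ?powR_gt0// mul1r.
  by apply: ge0_ler_powR; rewrite ?nnegrE ?subr_ge0 ?(ltW L0) ?(ltW Lg).
apply: (@le_trans _ _ (\int[mu]_(x in D) (L%:E + (L `^ (1 - s))%:E * (g x `^ s)%:E))).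
  apply: ge0_le_integral => //.
  - exact/measurable_EFinP.
  - by apply: emeasurable_funD => //; exact: measurable_funeM.
rewrite ge0_integralD//; last 3 first.
- by move=> x _; rewrite lee_fin ltW.
- by move=> x _; rewrite -EFinM lee_fin mulr_ge0 ?powR_ge0.
- exact: measurable_funeM.
rewrite integral_cst// muD ge0_integralZl_EFin ?powR_ge0//; last first.
  by move=> x _; rewrite lee_fin powR_ge0.
have -> : (2 * L * m = L * m + L `^ (1 - s) * (L `^ s * m))%R.
  rewrite mulrA -powRD; last by apply/implyP => _; rewrite gt_eqF.
  by rewrite subrK powRr1 ?ltW//; ring.
by rewrite EFinD EFinM leeD2l// EFinM lee_wpmul2l// lee_fin powR_ge0.
Qed.

End integrals.

(** * The group as a topological group, in exponential coordinates *)

Section topology.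
Context {R : realType} (G : stratifiedGroup R).

(** Smoothness is known for the product read in exponential coordinates; it
    is transported by the homeomorphisms exp and log. *)
Lemma group_mul_cvg (T : Type) (F : set_system T) (f g : T -> G) (a b : G) :
  Filter F -> f @ F --> a -> g @ F --> b -> (f t * g t)%g @[t --> F] --> (a * b)%g.
Proof.
move=> FF fa gb.
pose P (u v : 'rV[R]_(sg_dim G)) := sg_log (sg_exp u * sg_exp v)%g.
have -> : (fun t => (f t * g t)%g) =
    @sg_exp R G \o (fun t => P (sg_log (f t)) (sg_log (g t))).
  by apply/funext => t; rewrite /P /= !sg_logK.
have -> : (a * b)%g = sg_exp (P (sg_log a) (sg_log b)) by rewrite /P !sg_logK.
apply: continuous_cvg; first exact: sg_exp_cont.
apply: continuous2_cvg.
- have [cF _] := @sg_mul_smooth R G 0.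
  exact: (cF (sg_log a, sg_log b)).
- by apply: continuous_cvg => //; exact: sg_log_cont.
- by apply: continuous_cvg => //; exact: sg_log_cont.
Qed.

Lemma group_inv_cont : continuous (fun x : G => x^-1%g).
Proof.
have [cF _] := @sg_inv_smooth R G 0.
have -> : (fun x : G => x^-1%g) =
  @sg_exp R G \o (fun u => sg_log (sg_exp u)^-1%g) \o @sg_log R G.
  by apply/funext => x /=; rewrite !sg_logK.
move=> x; apply: continuous_comp; first exact: sg_log_cont.
apply: continuous_comp; last exact: sg_exp_cont.
exact: cF.
Qed.

Lemma group_lmul_cont (g : G) : continuous (fun x : G => (g * x)%g).
Proof. by move=> x; apply: group_mul_cvg; [exact: cvg_cst|exact: cvg_id]. Qed.

Lemma lmul_image (g : G) (A : set G) :
  [set (g * x)%g | x in A] = (fun x => g^-1 * x)%g @^-1` A.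
Proof.
apply/seteqP; split => [_ [x Ax <-]|x /= Ax] /=; first by rewrite mulKg.
by exists (g^-1 * x)%g => //; rewrite mulgA mulgV mul1g.
Qed.

Lemma open_lmul (g : G) (A : set G) : open A -> open [set (g * x)%g | x in A].
Proof.
rewrite lmul_image => oA; apply: open_comp => // x _; exact: group_lmul_cont.
Qed.

Lemma closed_lmul (g : G) (A : set G) :
  closed A -> closed [set (g * x)%g | x in A].
Proof.
rewrite lmul_image => oA; apply: closed_comp => // x _; exact: group_lmul_cont.
Qed.

Lemma compact_lmul (g : G) (A : set G) :
  compact A -> compact [set (g * x)%g | x in A].
Proof.
move=> cA; apply: continuous_compact => //.
by apply: continuous_subspaceT; exact: group_lmul_cont.
Qed.

Definition chart_ball (M : R) : set G := [set x | `|sg_log x| <= M].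

Lemma chart_ball_closed M : closed (chart_ball M).
Proof.
apply: (@closed_comp _ _ (fun x : G => `|sg_log x|) [set r : R | r <= M]);
  last exact: closed_le.
move=> x _; apply: continuous_comp; first exact: sg_log_cont.
exact: norm_continuous.
Qed.

Lemma chart_ball_compact M : compact (chart_ball M).
Proof.
have -> : chart_ball M =
    [set @sg_exp R G u | u in [set u : 'rV[R]_(sg_dim G) | `|u| <= M]].
  apply/seteqP; split => [x /= Bx|_ [u Bu <-]].
    by exists (sg_log x) => //; rewrite sg_logK.
  by rewrite /chart_ball /= sg_expK.
apply: continuous_compact.
  by apply: continuous_subspaceT; exact: sg_exp_cont.
apply: bounded_closed_compact.
  exists M; split; first exact: num_real.
  by move=> N MN u /= /le_trans; apply; exact: ltW.
apply: (@closed_comp _ _ (fun u : 'rV[R]_(sg_dim G) => `|u|) [set r : R | r <= M]);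
  last exact: closed_le.
by move=> x _; exact: norm_continuous.
Qed.

Lemma compact_chart_ball (K : set G) : compact K ->
  exists M : R, K `<=` chart_ball M.
Proof.
move=> cK.
have /compact_bounded[M [Mreal MK]] : compact [set @sg_log R G x | x in K].
  apply: continuous_compact => //.
  by apply: continuous_subspaceT; exact: sg_log_cont.
exists (`|M| + 1) => x Kx; rewrite /chart_ball /=; apply: (MK (`|M| + 1)).
  by rewrite (le_lt_trans (ler_norm _))// ltrDl.
by exists x.
Qed.

Definition rat_point (v : 'rV[rat]_(sg_dim G)) : G := sg_exp (map_mx ratr v).

Lemma rat_point_dense (O : set G) : open O -> O !=set0 ->
  exists v, O (rat_point v).
Proof.
move=> oO [x Ox].
have : nbhs (sg_log x) (@sg_exp R G @^-1` O).
  apply: sg_exp_cont; rewrite sg_logK; exact: open_nbhs_nbhs.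
move=> /nbhs_ballP[e /= e0 xeO].
have ex j : exists q : rat, `|sg_log x 0 j - ratr q| < e.
  have [|q] := @rat_in_itvoo R (sg_log x 0 j) (sg_log x 0 j + e).
    by rewrite ltrDl.
  rewrite in_itv/= => /andP[q1 q2]; exists q.
  by rewrite ltr_norml ltrBrDl ltrBlDl; apply/andP; split; lra.
exists (\row_j projT1 (cid (ex j))).
apply: xeO; split=> // i j; rewrite (ord1 i) !mxE; apply: (projT2 (cid (ex j))).
Qed.

End topology.

(** * Balls of the homogeneous norm *)

Section gballs.
Context {R : realType} (G : stratifiedGroup R).
Variables (rho : G -> R) (hrho : homogeneous_norm rho).

Lemma gball_open c r : open (gball rho c r).
Proof.
have -> : gball rho c r =
    (fun y : G => rho (y^-1 * c)%g) @^-1` [set s | s < r] by [].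
apply: open_comp; last exact: open_lt.
move=> y _; apply: continuous_comp; last exact: (hnorm_cont hrho).
by apply: group_mul_cvg; [exact: group_inv_cont|exact: cvg_cst].
Qed.

Lemma rho_sym (x y : G) : rho (y^-1 * x)%g = rho (x^-1 * y)%g.
Proof. by rewrite -(hnormV hrho) invgM invgK. Qed.

Lemma gball_center c r : 0 < r -> gball rho c r c.
Proof. by move=> r0; rewrite /gball /= mulVg (hnorm1 hrho). Qed.

Lemma gball_lmul g c r :
  gball rho (g * c)%g r = [set (g * x)%g | x in gball rho c r].
Proof.
rewrite lmul_image; apply/seteqP; split => x;
  by rewrite /gball /= !(invgM, invgK, mulgA).
Qed.

End gballs.

Section quasi_triangle.
Context {R : realType} (G : stratifiedGroup R).
Variables (rho : G -> R) (hrho : homogeneous_norm rho).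
Variables (c0 : R) (hc0 : 1 <= c0)
  (hM : forall x y : G, rho (x * y)%g <= c0 * (rho x + rho y)).

Lemma rho_triangle (x y z : G) :
  rho (z^-1 * x)%g <= c0 * (rho (y^-1 * x)%g + rho (z^-1 * y)%g).
Proof.
have -> : (z^-1 * x = (z^-1 * y) * (y^-1 * x))%g by rewrite -mulgA (mulgA y) mulgV mul1g.
by rewrite [X in _ * X]addrC.
Qed.

(** The engulfing property behind the covering argument: a ball that meets a
    ball of larger radius lies in its dilate by the factor 3 c0^2. *)
Lemma gball_engulf c r c' r' z : gball rho c r z -> gball rho c' r' z ->
  r' <= r -> gball rho c' r' `<=` gball rho c (3 * c0 ^+ 2 * r).
Proof.
move=> /= zc zc' rr' y /= yc'.
have c01 := hc0; have c00 : 0 < c0 by lra.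
have h1 := rho_triangle c c' y.
have h2 := rho_triangle c z c'.
rewrite /gball /= in zc zc' yc' *.
rewrite (rho_sym hrho z c') in h2.
have h3 : rho (c'^-1 * c)%g < 2 * c0 * r.
  apply: (le_lt_trans h2); rewrite mulrC -ltr_pdivlMr//.
  have -> : 2 * c0 * r / c0 = 2 * r by field; lra.
  lra.
apply: (le_lt_trans h1).
have r0 : 0 < r by apply: le_lt_trans zc; exact: (hnorm_ge0 hrho).
rewrite [ltLHS](_ : _ = c0 * rho (c'^-1 * c)%g + c0 * rho (y^-1 * c')%g); last by ring.
have : c0 * rho (c'^-1 * c)%g < c0 * (2 * c0 * r) by rewrite ltr_pM2l.
have : c0 * rho (y^-1 * c')%g < c0 * r by rewrite ltr_pM2l//; lra.
have : c0 * r <= c0 * c0 * r by rewrite ler_pM2r// ler_peMl//; lra.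
nra.
Qed.

End quasi_triangle.

(** * Borel sets, and relative compactness of the balls *)

Section borel.
Context {R : realType} (G : stratifiedGroup R).
Local Notation T := (borelType G).

Lemma open_borel (A : set G) : open A -> measurable (A : set T).
Proof. by move=> oA; exact: sub_sigma_algebra. Qed.

Lemma closed_borel (A : set G) : closed A -> measurable (A : set T).
Proof.
move=> cA; rewrite -(setCK A); apply: measurableC; apply: open_borel.
exact: closed_openC.
Qed.

Lemma lsc_borel (f : T -> \bar R) :
  (forall a : R, open [set x | (a%:E < f x)%E]) ->
  measurable_fun (setT : set T) f.
Proof.
move=> hf; apply: (measurability _ (ErealGenOInfty.measurableE R)).
move=> /= _ [_ [a ->]] <-; apply: measurableI => //.
by rewrite preimage_itvoy; apply: open_borel; exact: hf.
Qed.

Lemma continuous_borel (f : G -> R) : continuous f ->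
  measurable_fun (setT : set T) f.
Proof.
move=> cf; apply/measurable_EFinP; apply: lsc_borel => a /=.
have -> : [set x | (a%:E < (f x)%:E)%E] = f @^-1` [set y | a < y].
  by apply/seteqP; split => x /=; rewrite lte_fin.
by apply: open_comp; [move=> x _; exact: cf|exact: open_gt].
Qed.

End borel.

Section balls.
Context {R : realType} (G : stratifiedGroup R).
Local Notation T := (borelType G).
Variable mu : {measure set T -> \bar R}.
Hypothesis hmu : biinvariant_haar mu.
Variables (rho : G -> R) (hrho : homogeneous_norm rho).

Lemma gball_measurable c r : measurable (gball rho c r : set T).
Proof. by apply: open_borel; exact: gball_open. Qed.

Hypothesis hfin : forall r : R, 0 < r -> (mu (gball rho 1%g r) < +oo)%E.

(** If the ball were unbounded in the chart, one could choose in it, one after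
    the other, points h such that the translates h U of a fixed bounded open set
    U are pairwise disjoint. They all have the measure of U, and lie in a ball of
    larger radius, whose measure is finite. *)
Lemma gball1_bounded r : 0 < r -> exists M, gball rho 1%g r `<=` chart_ball (G:=G) M.
Proof.
move=> r0; apply: contrapT => /forallNP nM.
have {}nM M : exists2 h, gball rho 1%g r h & ~ chart_ball (G:=G) M h.
  by have /existsNP[h /not_implyP[]] := nM M; exists h.
have [c0 c01 hM] := hnormM hrho.
pose U : set G := [set x | `|sg_log x| < 1].
pose C := chart_ball (G:=G) 1.
have UC : U `<=` C by move=> x /ltW.
have oU : open U.
  apply: (@open_comp _ _ (fun x : G => `|sg_log x|) [set s : R | s < 1]);
    last exact: open_lt.
  by move=> x _; apply: continuous_comp; [exact: sg_log_cont|exact: norm_continuous].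
have U0 : U !=set0.
  by exists (sg_exp 0); rewrite /U /= sg_expK normr0.
have muU : (0 < mu U)%E := haar_open hmu oU U0.
have [s s0 Cs] : exists2 s, 0 < s & forall x, C x -> rho x < s.
  have /compact_bounded[s [_ hs]] : compact [set rho x | x in C].
    apply: continuous_compact; last exact: chart_ball_compact.
    by apply: continuous_subspaceT; exact: hnorm_cont hrho.
  exists (`|s| + 2); first by rewrite ltr_wpDl.
  move=> x Cx; apply: (le_lt_trans (ler_norm _)).
  apply: (@le_lt_trans _ _ (`|s| + 1)); last by rewrite ltrD2l ltr1n.
  apply: hs; last by exists x.
  by rewrite (le_lt_trans (ler_norm _))// ltrDl.
(* V is the union of n disjoint translates of U, and K is a compact set that
   contains it; the next translate is taken outside K C^-1. *)
have step (n : nat) : exists V K : set G, [/\ open V, compact K, V `<=` K,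
    V `<=` gball rho 1%g (c0 * (r + s)) & (n%:R%:E * mu U <= mu V)%E].
  elim: n => [|n [V [K [oV cK VK VB nV]]]].
    exists set0, set0; split => //; [exact: open0|exact: compact0|].
    by rewrite mul0e.
  have /compact_chart_ball[M KCM] : compact
      [set (u.1 * u.2^-1)%g | u in K `*` C].
    apply: continuous_compact; last first.
      by apply: compact_setX => //; exact: chart_ball_compact.
    apply: continuous_subspaceT => u; apply: group_mul_cvg.
      exact: cvg_fst.
    apply: (@continuous_comp _ _ _ snd (fun x : G => x^-1%g)).
      exact: cvg_snd.
    exact: group_inv_cont.
  have [h hr hMn] := nM M.
  pose hU := [set (h * x)%g | x in U].
  have ohU : open hU by exact: open_lmul.
  have VhU : V `&` hU = set0.
    rewrite -subset0 => x [Vx [u Uu hux]]; apply: hMn; apply: KCM.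
    exists (x, u) => /=; last by rewrite -hux -mulgA mulgV mulg1.
    by split => /=; [exact: VK|exact: UC].
  exists (V `|` hU), (K `|` [set (h * x)%g | x in C]); split.
  - exact: openU.
  - apply: compactU => //; apply: compact_lmul; exact: chart_ball_compact.
  - apply: setUSS => //; apply: image_subset; exact: UC.
  - move=> x [/VB//|[u Uu <-]]; rewrite /gball /= mulg1 (hnormV hrho).
    apply: (le_lt_trans (hM _ _)); rewrite ltr_pM2l ?(lt_le_trans ltr01)//.
    apply: ltrD; last by apply: Cs; exact: UC.
    by move: hr; rewrite /gball /= mulg1 (hnormV hrho).
  - rewrite (measureU mu _ _ VhU); [|exact: open_borel..].
    rewrite -natr1 EFinD ge0_muleDl// mul1e; apply: leeD => //.
    by rewrite -(haar_left hmu h (open_borel oU)).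
have c00 : 0 < c0 by rewrite (lt_le_trans ltr01).
have Bfin := @hfin (c0 * (r + s)) (mulr_gt0 c00 (addr_gt0 r0 s0)).
have bnd n : (n%:R%:E * mu U <= mu (gball rho 1%g (c0 * (r + s))))%E.
  have [V [K [oV _ _ VB nV]]] := step n.
  apply: (le_trans nV); apply: le_measure => //.
  - by rewrite inE; exact: open_borel.
  - by rewrite inE; exact: gball_measurable.
have muUfin : mu U \is a fin_num.
  rewrite ge0_fin_numE//; apply: le_lt_trans Bfin.
  by have := bnd 1%N; rewrite mul1e.
move: muU Bfin bnd; rewrite -(fineK muUfin) lte_fin => muU Bfin bnd.
have Bf : mu (gball rho 1%g (c0 * (r + s))) \is a fin_num by rewrite ge0_fin_numE.
move: bnd; rewrite -(fineK Bf) => bnd.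
pose N := Num.truncn (fine (mu (gball rho 1%g (c0 * (r + s)))) / fine (mu U)).
have := bnd N.+1; rewrite -EFinM lee_fin -ler_pdivlMr//.
by rewrite leNgt truncnS_gt.
Qed.

Lemma gball_compact c r : exists K : set G,
  [/\ compact K, closed K & gball rho c r `<=` K].
Proof.
have [r0|r0] := ltP 0 r; last first.
  exists set0; split; [exact: compact0|exact: closed0|].
  by move=> y; rewrite /gball /= ltNge (le_trans r0)// (hnorm_ge0 hrho).
have [M BM] := gball1_bounded r0.
exists [set (c * x)%g | x in chart_ball (G:=G) M]; split.
- by apply: compact_lmul; exact: chart_ball_compact.
- by apply: closed_lmul; exact: chart_ball_closed.
- by rewrite -[c in gball _ c]mulg1 gball_lmul; exact: image_subset.
Qed.

Lemma loc_integrable_gball (b : G -> R) : loc_integrable mu b ->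
  forall c r, mu.-integrable (gball rho c r) (EFin \o b).
Proof.
move=> [mb bK] c r; have [K [cK clK BK]] := gball_compact c r.
apply/integrableP; split.
  apply: measurable_funS (measurableT) (@subsetT _ _) _.
  exact/measurable_EFinP.
apply: le_lt_trans (bK _ cK); apply: ge0_subset_integral => //.
- exact: gball_measurable.
- exact: closed_borel.
- apply: measurableT_comp => //; apply: measurable_funS (measurableT) (@subsetT _ _) _.
  exact/measurable_EFinP.
Qed.

End balls.

(** * A Vitali covering argument *)

Section vitali.
Context {R : realType} (G : stratifiedGroup R).
Local Notation T := (borelType G).
Variable mu : {measure set T -> \bar R}.
Variables (rho : G -> R) (hrho : homogeneous_norm rho).
Variables (c0 : R) (hc0 : 1 <= c0)
  (hM : forall x y : G, rho (x * y)%g <= c0 * (rho x + rho y)).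
Local Notation K := (3 * c0 ^+ 2).
Local Notation ball p := (gball rho p.1 p.2).
Local Notation mball := (gball_measurable hrho).

Local Open Scope ereal_scope.

Section densities.
Variables (F1 F2 : T -> \bar R).
Hypotheses (mF1 : measurable_fun setT F1) (mF2 : measurable_fun setT F2).
Hypotheses (F10 : forall x, 0 <= F1 x) (F20 : forall x, 0 <= F2 x).
Variables (A : R) (A0 : (0 <= A)%R).

Let union (s : seq (G * R)) : set T := \bigcup_(p in [set` s]) ball p.

Let union_measurable s : measurable (union s).
Proof. by apply: fin_bigcup_measurable => // p _; exact: mball. Qed.

(** By induction on the number of balls: the balls of the family that meet a
    ball B of largest radius are in its dilate, and the others are disjoint from
    B, so that B and their union contribute separately to the integral of F2. *)
Lemma vitali_finite (s : seq (G * R)) :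
  (forall p, p \in s -> (0 < p.2)%R /\
    \int[mu]_(x in gball rho p.1 (K * p.2)) F1 x <= A%:E * \int[mu]_(x in ball p) F2 x) ->
  \int[mu]_(x in union s) F1 x <= A%:E * \int[mu]_(x in union s) F2 x.
Proof.
have [n] := ubnP (size s); elim: n s => // n IH s.
rewrite ltnS => sn hs.
have [->|[p ps pmax]] : s = [::] \/
    exists2 p, p \in s & forall q, q \in s -> (q.2 <= p.2)%R.
- clear; elim: s => [|q s [->|[p ps pmax]]]; first by left.
    by right; exists q; rewrite ?mem_head// => q'; rewrite inE => /eqP ->.
  right; have [qp|pq] := leP q.2 p.2.
    exists p; first by rewrite inE ps orbT.
    by move=> q'; rewrite inE => /orP[/eqP ->//|]; exact: pmax.
  exists q; first by rewrite mem_head.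
  move=> q'; rewrite inE => /orP[/eqP ->//|/pmax h].
  by rewrite (le_trans h)// ltW.
- by rewrite /union set_nil bigcup_set0 !integral_set0 mule0.
(* The balls of s disjoint from the largest one; the others are in its dilate. *)
pose s' := [seq q <- s | `[< ball p `&` ball q = set0 >]].
have [p0 hp] := hs p ps.
have ps' : p \notin s'.
  rewrite mem_filter ps andbT; apply/asboolPn => e.
  have : (ball p `&` ball p) p.1 by rewrite setIid; exact: gball_center.
  by rewrite e.
have s'n : (size s' < n)%N.
  apply: leq_trans sn; rewrite size_filter.
  rewrite -(count_predC (fun q => `[< ball p `&` ball q = set0 >]) s).
  rewrite -addn1 leq_add2l -has_count; apply/hasP; exists p => //=.
  by move: ps'; rewrite mem_filter ps andbT.
have sub1 : union s `<=` gball rho p.1 (K * p.2) `|` union s'.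
  move=> x [q /= qs qx]; have [qp|qp] := pselect (ball p `&` ball q = set0).
    by right; exists q => //=; rewrite mem_filter qs andbT; apply/asboolP.
  left; have /set0P[z [pz qz]] : ball p `&` ball q != set0 by apply/eqP.
  by apply: (gball_engulf hrho hc0 hM pz qz _ qx); exact: pmax.
have sub2 : ball p `|` union s' `<=` union s.
  move=> x [px|[q /= ]]; first by exists p.
  by rewrite mem_filter => /andP[_ qs] qx; exists q.
have dis : ball p `&` union s' = set0.
  rewrite -subset0 => x [px [q /=]]; rewrite mem_filter => /andP[/asboolP e _] qx.
  by suff : (set0 : set G) x by []; rewrite -e.
apply: (@le_trans _ _ (\int[mu]_(x in gball rho p.1 (K * p.2) `|` union s') F1 x)).
  apply: ge0_subset_integral => //.
  - by apply: measurableU => //; exact: mball.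
  - exact: measurable_funS mF1.
apply: le_trans (integral_setU_le _ mF1 F10 _ _) _ => //; first exact: mball.
apply: (@le_trans _ _ (A%:E * \int[mu]_(x in ball p `|` union s') F2 x)); last first.
  rewrite lee_wpmul2l// ?lee_fin//; apply: ge0_subset_integral => //.
  - by apply: measurableU => //; exact: mball.
  - exact: measurable_funS mF2.
rewrite ge0_integral_setU//=; last 3 first.
- exact: mball.
- exact: measurable_funS mF2.
- by rewrite disj_set2E dis.
rewrite ge0_muleDr; [|exact: integral_ge0..].
apply: leeD => //; apply: IH => // q; rewrite mem_filter => /andP[_]; exact: hs.
Qed.

(** Two uses: with F1 = 1 and F2 a truncation of |f| it gives the weak type
    estimate; with F1 = |b - b'| and F2 = 1 it shows that b = b' almost
    everywhere. *)
Lemma vitali_countable (B : nat -> G * R) (P : set nat) (O : set T) :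
  measurable O -> (forall i, P i -> ball (B i) `<=` O) ->
  (forall i, P i -> (0 < (B i).2)%R /\
    \int[mu]_(x in gball rho (B i).1 (K * (B i).2)) F1 x <=
      A%:E * \int[mu]_(x in ball (B i)) F2 x) ->
  \int[mu]_(x in \bigcup_(i in P) ball (B i)) F1 x <= A%:E * \int[mu]_(x in O) F2 x.
Proof.
move=> mO BO hB.
pose s n := [seq B i | i <- iota 0 n & `[< P i >]].
have sP n q : q \in s n -> exists2 i, P i & q = B i.
  by move=> /mapP[i]; rewrite mem_filter => /andP[/asboolP Pi _] ->; exists i.
have -> : \bigcup_(i in P) ball (B i) = \bigcup_n union (s n).
  apply/seteqP; split => x.
    move=> [i Pi xi]; exists i.+1 => //; exists (B i) => //=.
    apply/mapP; exists i => //; rewrite mem_filter mem_iota/= add0n ltnS leqnn andbT.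
    exact/asboolP.
  by move=> [n _ [q /= /sP[i Pi ->] qx]]; exists i.
have nd : nondecreasing_seq (fun n => union (s n)).
  move=> m n mn; rewrite subsetEset => x [q /= qs qx]; exists q => //=.
  move: qs => /mapP[i]; rewrite mem_filter mem_iota/= add0n => /andP[Pi im] ->.
  by apply/mapP; exists i => //; rewrite mem_filter mem_iota/= add0n Pi (leq_trans im).
have cv : \int[mu]_(x in union (s n)) F1 x @[n --> \oo] -->
          \int[mu]_(x in \bigcup_n union (s n)) F1 x.
  apply: ge0_nondecreasing_set_cvg_integral => // i; exact: measurable_funS mF1.
rewrite -(cvg_lim _ cv)//; apply: lime_le; first by apply/cvg_ex; eexists; exact: cv.
apply: nearW => n.
apply: (@le_trans _ _ (A%:E * \int[mu]_(x in union (s n)) F2 x)).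
  by apply: vitali_finite => q /sP[i Pi ->]; exact: hB.
rewrite lee_wpmul2l// ?lee_fin//; apply: ge0_subset_integral => //.
- exact: measurable_funS mF2.
- by move=> x [q /= /sP[i Pi ->]]; exact: BO.
Qed.

End densities.
End vitali.

Section countable_balls.
Context {R : realType} (G : stratifiedGroup R).
Variables (rho : G -> R) (hrho : homogeneous_norm rho).

(** The balls with rational radius whose center has rational exponential
    coordinates, enumerated; the indices that code no ball give the unit ball. *)
Definition rat_ball (i : nat) : G * R :=
  if unpickle i is Some vq then
    (rat_point (vq : 'rV[rat]_(sg_dim G) * rat).1, ratr vq.2) else (1%g, 1).

Lemma rat_ballP (c : G) (r s t : R) : 0 < r -> s < t ->
  exists i, [/\ gball rho c r (rat_ball i).1, s < (rat_ball i).2 & (rat_ball i).2 < t].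
Proof.
move=> r0 st.
have [v cv] := rat_point_dense (gball_open hrho c r) (ex_intro _ _ (gball_center hrho c r0)).
have [q] := rat_in_itvoo st; rewrite in_itv/= => /andP[q1 q2].
by exists (pickle (v, q)); rewrite /rat_ball pickleK.
Qed.
End countable_balls.

(** * Maximal functions and the weak type estimate *)

Section weak_type.
Context {R : realType} (G : stratifiedGroup R).
Local Notation T := (borelType G).
Variable mu : {measure set T -> \bar R}.
Variables (rho : G -> R) (hrho : homogeneous_norm rho).
Local Notation mball := (gball_measurable hrho).
Local Notation Q := (hom_dim G).
Local Notation M alpha f := (frac_maximal mu rho alpha f).
Variables (c1 : R) (c1_gt0 : 0 < c1).
Local Notation vol r := (c1 * r ^+ Q).
Hypothesis hvol : forall (x : G) (r : R), 0 < r -> mu (gball rho x r) = (vol r)%:E.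

Lemma vol_gt0 r : 0 < r -> 0 < vol r.
Proof. by move=> r0; rewrite mulr_gt0 ?exprn_gt0. Qed.

Lemma frac_averageE alpha (f : G -> R) c r : 0 < r ->
  frac_average mu rho alpha f c r =
  ((vol r `^ (alpha / Q%:R - 1))%:E * \int[mu]_(y in gball rho c r) `|f y|%:E)%E.
Proof.
move=> r0; rewrite /frac_average hvol// poweR_EFin inver gt_eqF ?powR_gt0 ?vol_gt0//.
by rewrite -powRN opprB.
Qed.

Lemma frac_average_ge0 alpha (f : G -> R) c r : 0 < r ->
  (0 <= frac_average mu rho alpha f c r)%E.
Proof.
move=> r0; rewrite frac_averageE// mule_ge0 ?lee_fin ?powR_ge0//.
by apply: integral_ge0 => y _; rewrite lee_fin.
Qed.

Lemma frac_average_le alpha f c r x : 0 < r -> gball rho c r x ->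
  (frac_average mu rho alpha f c r <= M alpha f x)%E.
Proof. by move=> r0 xB; apply: ereal_sup_ubound; exists c, r. Qed.

Lemma frac_maximal_le alpha f x z :
  (forall c r, 0 < r -> gball rho c r x -> (frac_average mu rho alpha f c r <= z)%E) ->
  (M alpha f x <= z)%E.
Proof. by move=> h; apply: ge_ereal_sup => _ [c [r [r0 xB ->]]]; exact: h. Qed.

Lemma frac_maximal_ge0 alpha f x : (0 <= M alpha f x)%E.
Proof.
apply: le_trans (frac_average_le alpha f ltr01 (gball_center hrho x ltr01)).
exact: frac_average_ge0.
Qed.

(** A supremum over the balls that contain the point is lower semicontinuous,
    its superlevel sets being unions of balls. *)
Lemma measurable_ball_sup (P : G -> R -> Prop) (W : G -> R -> \bar R) :
  measurable_fun (setT : set T) (fun x => ereal_sup [set z | exists c r,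
    [/\ 0 < r, gball rho c r x, P c r & z = W c r]]).
Proof.
apply: lsc_borel => a.
pose I := [set p : G * R | [/\ 0 < p.2, P p.1 p.2 & (a%:E < W p.1 p.2)%E]].
rewrite [X in open X](_ : _ = \bigcup_(p in I) gball rho p.1 p.2).
  by apply: bigcup_open => p _; exact: gball_open.
apply/seteqP; split => x /=.
  by move=> /ereal_sup_gt[_ [c [r [r0 xB Pcr ->]] aW]]; exists (c, r).
move=> [[c r] /= [r0 Pcr aW] xB]; apply: (lt_le_trans aW).
by apply: ereal_sup_ubound; exists c, r.
Qed.

Lemma measurable_frac_maximal alpha f : measurable_fun (setT : set T) (M alpha f).
Proof.
rewrite [X in measurable_fun _ X](_ : _ = fun x => ereal_sup [set z | exists c r,
    [/\ 0 < r, gball rho c r x, True & z = frac_average mu rho alpha f c r]]).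
  exact: measurable_ball_sup.
apply/funext => x; congr ereal_sup; apply/seteqP; split => z [c [r []]].
  by move=> r0 xB ->; exists c, r.
by move=> r0 xB _ ->; exists c, r.
Qed.

Lemma superlevel_frac_maximal alpha f (t : R) :
  measurable ([set x | t%:E < M alpha f x]%E : set T).
Proof.
rewrite -preimage_itvoy -[X in measurable X]setTI.
by apply: measurable_frac_maximal => //; exact: emeasurable_itv.
Qed.

Lemma measurable_frac_maximal_in alpha (B : set G) f :
  measurable_fun (setT : set T) (frac_maximal_in mu rho alpha B f).
Proof. exact: measurable_ball_sup. Qed.

Variables (c0 : R) (hc0 : 1 <= c0)
  (hM : forall x y : G, rho (x * y)%g <= c0 * (rho x + rho y)).

(** The factors come from the truncation at half the level, from the
    dilation in the covering argument, and from the passage to a rational ball. *)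
Definition weak_const : R := 2 * (3 * c0 ^+ 2) ^+ Q * (3 * c0) ^+ Q.

Lemma weak_const_ge0 : 0 <= weak_const.
Proof.
have c00 : 0 <= c0 by rewrite (le_trans ler01).
by rewrite /weak_const !mulr_ge0 ?exprn_ge0 ?mulr_ge0 ?exprn_ge0.
Qed.

Local Open Scope ereal_scope.

(** A ball where the mean of |f| exceeds t is one where the mean of the part of
    |f| above t / 2 exceeds t / 2. Each such ball lies in a ball of comparable
    radius from a countable family, to which the covering argument applies. *)
Lemma weak_type (f : T -> R) (t : R) : measurable_fun setT f -> (0 < t)%R ->
  mu [set x | t%:E < M 0 f x] <=
  (weak_const / t)%:E * \int[mu]_x (if (t < 2 * `|f x|)%R then `|f x| else 0%R)%:E.
Proof.
move=> mf t0; have c01 := hc0.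
set F := fun x => (if _ then _ else _)%:E.
have F0 x : 0 <= F x by rewrite /F; case: ifP; rewrite lee_fin.
have mnf : measurable_fun setT (fun x : T => `|f x|%R) by exact: measurableT_comp.
have mF : measurable_fun setT F.
  apply/measurable_EFinP; apply: measurable_fun_ifT => //.
  by apply: measurable_fun_ltr => //; exact: measurable_funM.
(* P selects the rational balls to which the covering lemma applies. *)
pose A := (weak_const / t)%R.
pose P := [set i | (0 < (rat_ball G i).2)%R /\
   (vol (3 * c0 ^+ 2 * (rat_ball G i).2))%:E <=
   A%:E * \int[mu]_(x in gball rho (rat_ball G i).1 (rat_ball G i).2) F x].
apply: (@le_trans _ _ (mu (\bigcup_(i in P) gball rho (rat_ball G i).1 (rat_ball G i).2))).
  apply: le_measure; rewrite ?inE.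
  - exact: superlevel_frac_maximal.
  - by apply: bigcup_measurable => i _; exact: mball.
  move=> x /= /ereal_sup_gt[_ [c [r [r0 xB ->]]]].
  rewrite frac_averageE// mul0r sub0r powRN powRr1 ?ltW ?vol_gt0//.
  rewrite muleC lte_pdivlMr ?vol_gt0// => hlt.
  have [|i [iB s1 s2]] := rat_ballP hrho c r0 (_ : 2 * c0 * r < 3 * c0 * r)%R.
    by rewrite ltr_pM2r// ltr_pM2r ?ltr_nat// (lt_le_trans ltr01).
  set v := (rat_ball G i).1 in iB *; set s := (rat_ball G i).2 in s1 s2 *.
  have sub : gball rho c r `<=` gball rho v s.
    move=> y yB; rewrite /gball /=; apply: le_lt_trans s1.
    apply: (le_trans (rho_triangle hM v c y)).
    rewrite (rho_sym hrho) [leRHS](_ : _ = c0 * (r + r))%R; last by ring.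
    apply: ler_wpM2l; first lra.
    by apply: lerD; exact: ltW.
  have s0 : (0 < s)%R by apply: lt_trans s1; rewrite !mulr_gt0//; lra.
  exists i; last exact: sub.
  split => //; rewrite -/v -/s.
  apply: (@le_trans _ _ ((2 / t * (3 * c0 ^+ 2) ^+ Q * (3 * c0) ^+ Q)%:E * (t / 2 * vol r)%:E)).
    rewrite -EFinM lee_fin.
    have -> : (2 / t * (3 * c0 ^+ 2) ^+ Q * (3 * c0) ^+ Q * (t / 2 * vol r) =
       c1 * ((3 * c0 ^+ 2) ^+ Q * (3 * c0 * r) ^+ Q))%R.
      rewrite (exprMn Q (3 * c0)%R r).
      move: ((3 * c0 ^+ 2) ^+ Q)%R ((3 * c0) ^+ Q)%R (r ^+ Q)%R => a b d.
      by field; lra.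
    rewrite ler_pM2l// exprMn ler_wpM2l//; first by rewrite exprn_ge0// mulr_ge0// exprn_ge0//; lra.
    by rewrite lerXn2r ?nnegrE//; [lra|rewrite !mulr_ge0//; lra|exact: ltW].
  have -> : A = (2 / t * (3 * c0 ^+ 2) ^+ Q * (3 * c0) ^+ Q)%R.
    rewrite /A /weak_const.
    move: ((3 * c0 ^+ 2) ^+ Q)%R ((3 * c0) ^+ Q)%R => a b.
    by field; lra.
  apply: lee_wpmul2l.
    rewrite lee_fin !mulr_ge0 ?invr_ge0 ?exprn_ge0 ?mulr_ge0 ?exprn_ge0//; lra.
  apply: (@le_trans _ _ (\int[mu]_(x in gball rho c r) F x)); last first.
    apply: ge0_subset_integral => //; try exact: mball.
    exact: measurable_funS mF.
  rewrite -(@leeD2rE _ (t / 2 * vol r)%:E)//.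
  apply: (@le_trans _ _ (\int[mu]_(x in gball rho c r) `|f x|%:E)).
    by rewrite -EFinD -mulrDl -splitr EFinM; exact: ltW.
  apply: (@le_trans _ _ (\int[mu]_(x in gball rho c r) (F x + (t / 2)%:E))).
    apply: ge0_le_integral => //; try exact: mball.
    - by apply/measurable_EFinP; exact: measurable_funS mnf.
    - by apply: emeasurable_funD; [exact: measurable_funS mF|exact: measurable_cst].
    - move=> y _; rewrite /F; case: ifPn => [_|].
        by rewrite -EFinD lee_fin lerDl; lra.
      by rewrite -leNgt add0e lee_fin; lra.
  rewrite ge0_integralD//; last 3 first.
  - exact: mball.
  - exact: measurable_funS mF.
  - by move=> y _; rewrite lee_fin; lra.
  by rewrite integral_cst ?hvol//; exact: mball.
have -> : mu (\bigcup_(i in P) gball rho (rat_ball G i).1 (rat_ball G i).2) =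
  \int[mu]_(x in \bigcup_(i in P) gball rho (rat_ball G i).1 (rat_ball G i).2) (cst 1 x).
  by rewrite integral_cst ?mul1e//; apply: bigcup_measurable => i _; exact: mball.
apply: (vitali_countable hrho hc0 hM) => //.
- by rewrite divr_ge0 ?weak_const_ge0 ?ltW.
- move=> i [s0 h]; split => //.
  rewrite integral_cst ?mul1e; last exact: mball.
  by rewrite hvol// !mulr_gt0 ?exprn_gt0//; lra.
Qed.

End weak_type.

(** * The strong type estimate for the Hardy-Littlewood maximal function *)

Section einf.
Context {R : realType}.
Local Open Scope ereal_scope.
Implicit Type u : (\bar R)^nat.

Lemma le_limn_einf u (c : \bar R) N : (forall n, (N <= n)%N -> c <= u n) ->
  c <= limn_einf u.
Proof.
move=> h; rewrite limn_einf_lim (cvg_lim _ (cvg_einfs_sup (u := u)))//.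
apply: (@le_trans _ _ (einfs u N)); last by apply: ereal_sup_ubound; exists N.
by apply: le_ereal_inf_tmp => _ [n /= Nn <-]; exact: h.
Qed.

Lemma limn_einf_le u (c : \bar R) : (forall n, u n <= c) -> limn_einf u <= c.
Proof.
move=> h; rewrite limn_einf_lim; apply: lime_le; first exact: is_cvg_einfs.
apply: nearW => n; apply: le_trans (h n); apply: ereal_inf_lbound.
by exists n => /=.
Qed.

End einf.

Section dyadic.
Context {R : realType}.
Variables (a : R) (a0 : 0 < a).

Definition geom_const : R := (1 - 2 `^ (- a))^-1.

Let w : R := 2 `^ (- a).

Let w1 : w < 1.
Proof. rewrite /w powRN invf_lt1 ?powR_gt0//.
have := @gt0_ltr_powR _ a a0 1 2; rewrite !nnegrE powR1 => -> //.
by rewrite ltr1n. Qed.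

Lemma geom_const_gt0 : 0 < geom_const.
Proof. by rewrite invr_gt0 subr_gt0. Qed.

Lemma geom_constE : geom_const * 2 `^ (- a) + 1 = geom_const.
Proof.
have w1' : 1 - w != 0 by rewrite subr_eq0 eq_sym lt_eqF.
by rewrite /geom_const -/w; field.
Qed.

Lemma geometric_sum_le (t0 : R) m : 0 < t0 ->
  \sum_(k < m.+1) (t0 * 2 ^+ k) `^ a <= geom_const * (t0 * 2 ^+ m) `^ a.
Proof.
move=> t00.
have gE : geom_const * w + 1 = geom_const := geom_constE.
have g1 : 1 <= geom_const.
  by rewrite -gE lerDr mulr_ge0 ?powR_ge0// ltW// geom_const_gt0.
elim: m => [|m IH].
  by rewrite big_ord_recr big_ord0 /= add0r expr0 mulr1 ler_peMl// powR_ge0.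
rewrite big_ord_recr /=; set x := (t0 * 2 ^+ m.+1) `^ a.
have xm : (t0 * 2 ^+ m) `^ a = w * x.
  rewrite /w /x powRN exprS mulrCA (powRM _ (ler0n _ 2)).
    by rewrite mulKf// powR_eq0.
  by rewrite mulr_ge0 ?exprn_ge0 ?ltW.
apply: (@le_trans _ _ (geom_const * (w * x) + x)); first by rewrite lerD2r -xm.
by rewrite -[in leRHS]gE mulrDl mul1r mulrA.
Qed.

(** The terms are increasing, so the last one below s dominates the sum. *)
Lemma truncated_geometric_sum_le (t0 s : R) m : 0 < t0 ->
  \sum_(k < m) (if t0 * 2 ^+ k < s then (t0 * 2 ^+ k) `^ a else 0) <=
  geom_const * s `^ a.
Proof.
move=> t00; elim: m => [|m IH].
  by rewrite big_ord0 mulr_ge0 ?powR_ge0// ltW// geom_const_gt0.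
rewrite big_ord_recr /=; case: ifPn => [ts|_]; last by rewrite addr0.
apply: (@le_trans _ _ (\sum_(k < m.+1) (t0 * 2 ^+ k) `^ a)).
  rewrite big_ord_recr /= lerD2r; apply: ler_sum => k _.
  by case: ifP => // _; exact: powR_ge0.
apply: le_trans (geometric_sum_le _ t00) _.
have tm0 : 0 <= t0 * 2 ^+ m by rewrite mulr_ge0 ?exprn_ge0 ?ltW.
rewrite ler_pM2l ?geom_const_gt0// ge0_ler_powR ?nnegrE//; try exact: ltW.
exact/ltW/(le_lt_trans tm0).
Qed.

Lemma dyadic_cover (N : nat) (v : R) : 2 ^- N < v -> v <= 2 ^+ N ->
  exists2 k, (k < N + N)%N & 2 ^- N * 2 ^+ k < v <= 2 * (2 ^- N * 2 ^+ k).
Proof.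
move=> Nv vN.
have E : v <= 2 ^- N * 2 ^+ (N + N) by rewrite exprD mulKf// expf_neq0.
elim: (N + N)%N E => [|m IH] E.
  by move: E; rewrite expr0 mulr1 leNgt Nv.
have [h|h] := leP v (2 ^- N * 2 ^+ m).
  by have [k km hk] := IH h; exists k => //; rewrite ltnS ltnW.
by exists m => //; rewrite h /= mulrCA -exprS.
Qed.

End dyadic.

Section strong_type.
Context {R : realType} (G : stratifiedGroup R).
Local Notation T := (borelType G).
Variable mu : {measure set T -> \bar R}.
Variables (rho : G -> R) (hrho : homogeneous_norm rho).
Local Notation mball := (gball_measurable hrho).
Local Notation Q := (hom_dim G).
Local Notation M alpha f := (frac_maximal mu rho alpha f).
Variables (c1 : R) (c1_gt0 : 0 < c1).
Local Notation vol r := (c1 * r ^+ Q).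
Hypothesis hvol : forall (x : G) (r : R), 0 < r -> mu (gball rho x r) = (vol r)%:E.

Local Open Scope ereal_scope.

(** The maximal function is compared with the sum over the dyadic levels t_k
    from 2^-N to 2^N of (2 t_k)^p times the indicator of its superlevel set. The
    weak type estimate bounds the integral of this sum by that of
    |f| times the sum of t_k^(p-1) over t_k < 2 |f|, a geometric sum of size
    |f|^(p-1). The bound is uniform in N, and Fatou's lemma lets N grow. *)
Lemma maximal_strong_type (p : R) : (1 < p)%R -> exists2 C : R, (0 <= C)%R &
  forall f : T -> R, measurable_fun setT f ->
  \int[mu]_x (M 0 f x `^ p) <= C%:E * \int[mu]_x (`|f x| `^ p)%:E.
Proof.
move=> p1; have [c0 c01 hM] := hnormM hrho.
have p0 : (0 < p)%R by rewrite (lt_trans ltr01).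
have p10 : (0 < p - 1)%R by rewrite subr_gt0.
pose W := weak_const G c0; pose D := geom_const (p - 1).
have W0 : (0 <= W)%R by exact: weak_const_ge0.
have D0 : (0 < D)%R by exact: geom_const_gt0.
exists (2 `^ p * W * (D * 2 `^ (p - 1)))%R.
  exact: mulr_ge0 (mulr_ge0 (powR_ge0 _ _) W0) (mulr_ge0 (ltW D0) (powR_ge0 _ _)).
move=> f mf; set C := (_ * (D * _))%R.
pose t (N k : nat) : R := (2 ^- N * 2 ^+ k)%R.
have t0 N k : (0 < t N k)%R by rewrite mulr_gt0 ?invr_gt0 ?exprn_gt0.
pose E N k : set T := [set x : T | (t N k)%:E < M 0 f x].
pose h (N : nat) (x : T) : \bar R := \sum_(k < N + N)
   (((2 * t N k) `^ p)%:E * (\1_(E N k) x)%:E).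
have mnf : measurable_fun setT (fun x : T => `|f x|%R) by exact: measurableT_comp.
have msup N k : measurable (E N k) by exact: superlevel_frac_maximal.
have mh1 N k : measurable_fun setT (fun x : T => ((2 * t N k) `^ p)%:E *
    (\1_(E N k) x)%:E).
  by apply: measurable_funeM; apply/measurable_EFinP; exact: measurable_indic.
have mh N : measurable_fun setT (h N) by exact: emeasurable_sum.
have h1_ge0 N k x : 0 <= ((2 * t N k) `^ p)%:E *
    (\1_(E N k) x)%:E.
  by rewrite mule_ge0// lee_fin ?powR_ge0.
have h_ge0 N x : 0 <= h N x by apply: sume_ge0.
have int_h N : \int[mu]_x h N x <= C%:E * \int[mu]_x (`|f x| `^ p)%:E.
  rewrite ge0_integral_sum//.
  pose phi k x := if (t N k < 2 * `|f x|)%R then `|f x|%R else 0%R.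
  have phi0 k x : (0 <= phi k x)%R by rewrite /phi; case: ifP.
  have mphi k : measurable_fun setT (fun x : T => (phi k x)%:E).
    apply/measurable_EFinP; apply: measurable_fun_ifT => //.
    by apply: measurable_fun_ltr => //; exact: measurable_funM.
  pose d k := ((2 * t N k) `^ p * (W / t N k))%R.
  have d0 k : (0 <= d k)%R by rewrite /d mulr_ge0 ?powR_ge0// divr_ge0// ltW.
  apply: (@le_trans _ _ (\sum_(k < N + N) \int[mu]_x ((d k)%:E * (phi k x)%:E))).
    apply: lee_sum => k _.
    rewrite ge0_integralZl_EFin ?powR_ge0//; last first.
      by apply/measurable_EFinP; exact: measurable_indic.
    rewrite integral_indic// setIT ge0_integralZl_EFin//; last first.
      by move=> x _; rewrite lee_fin.
    rewrite /d EFinM -muleA; apply: lee_wpmul2l; first by rewrite lee_fin powR_ge0.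
    exact: (weak_type hrho c1_gt0 hvol c01 hM mf (t0 N k)).
  rewrite -ge0_integral_sum//; last 2 first.
  - by move=> k; exact: measurable_funeM.
  - by move=> k x _; rewrite mule_ge0// lee_fin.
  have mpow : measurable_fun setT (fun x : T => (`|f x| `^ p)%:E).
    apply/measurable_EFinP; exact: (measurableT_comp (measurable_powR _)).
  rewrite -ge0_integralZl_EFin//; last first.
    exact: mulr_ge0 (mulr_ge0 (powR_ge0 _ _) W0) (mulr_ge0 (ltW D0) (powR_ge0 _ _)).
  apply: ge0_le_integral => //.
  - by move=> x _; apply: sume_ge0 => k _; rewrite mule_ge0// lee_fin.
  - by apply: emeasurable_sum => k; exact: measurable_funeM.
  - exact: measurable_funeM.
  move=> x _; rewrite -EFinM.
  under eq_bigr do rewrite -EFinM.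
  rewrite sumEFin lee_fin.
  have -> : (\sum_(k < N + N) d k * phi k x = 2 `^ p * W * (`|f x| *
      \sum_(k < N + N) (if 2 ^- N * 2 ^+ k < 2 * `|f x| then (2 ^- N * 2 ^+ k) `^ (p - 1) else 0)))%R.
    rewrite !mulr_sumr; apply: eq_bigr => k _; rewrite /phi /d -/(t N k).
    case: ifP => _; last by rewrite !mulr0.
    rewrite powRM ?ltW// -(mulr_powRB1 (ltW (t0 N k)) p0).
    by field; rewrite gt_eqF.
  rewrite /C -[leRHS]mulrA; apply: ler_wpM2l; first by rewrite mulr_ge0 ?powR_ge0.
  rewrite -(@mulr_powRB1 _ `|f x|) //.
  rewrite mulrCA; apply: ler_wpM2l => //; rewrite -mulrA -powRM//.
  exact: truncated_geometric_sum_le.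
apply: (@le_trans _ _ (\int[mu]_x limn_einf (h ^~ x))); last first.
  apply: (le_trans (fatou _ _ _ _)) => //.
  exact: limn_einf_le.
have hk N k x : (k < N + N)%N -> (t N k)%:E < M 0 f x ->
    ((2 * t N k) `^ p)%:E <= h N x.
  move=> kN lt; rewrite /h (bigD1 (Ordinal kN))//= indicE mem_set// mule1.
  by rewrite leeDl// sume_ge0.
apply: ge0_le_integral => //.
- by move=> x _; exact: poweR_ge0.
- apply: (measurableT_comp (measurable_poweR _)).
  exact: measurable_frac_maximal.
- apply: (emeasurable_fun_cvg (fun n (x : T) => einfs (h ^~ x) n)).
    by move=> n; exact: measurable_fun_einfs.
  by move=> x _; rewrite limn_einf_lim; exact: is_cvg_einfs.
move=> x _; have := frac_maximal_ge0 hrho c1_gt0 hvol 0 f x.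
case vE : (M 0 f x) => [v| |//]; rewrite ?lee_fin => v0.
- have [->|vn0] := eqVneq v 0%R.
    rewrite poweR_EFin powR0 ?gt_eqF//.
    by apply: (@le_limn_einf _ _ _ 0%N) => N _.
  have {vn0} v0' : (0 < v)%R by rewrite lt_def vn0.
  have [N1 hN1] : exists N1, forall N, (N1 <= N)%N -> (2 ^- N < v)%R /\ (v <= 2 ^+ N)%R.
    pose m := Num.truncn (Num.max v v^-1)%R; exists m.+1 => N mN.
    have : (Num.max v v^-1 < 2 ^+ N)%R.
      apply: lt_trans (truncnS_gt _) _; rewrite -natrX ltr_nat.
      exact: leq_ltn_trans mN (ltn_expl _ _).
    rewrite gt_max => /andP[h1 h2]; split; last exact: ltW.
    by rewrite invf_plt ?posrE// exprn_gt0.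
  apply: (@le_limn_einf _ _ _ N1) => N /hN1[Nv vN].
  have [k kN /andP[tv vt]] := dyadic_cover Nv vN.
  apply: le_trans (hk N k x kN _); last by rewrite vE lte_fin.
  rewrite poweR_EFin lee_fin; apply: ge0_ler_powR => //; rewrite ?nnegrE//.
    exact: ltW.
  by rewrite mulr_ge0// ltW.
rewrite poweRyr ?gt_eqF// leye_eq; apply/eqP/eq_infty => r.
pose m := Num.truncn r; apply: (@le_limn_einf _ _ _ m.+1) => N mN.
have N0 : (0 < N)%N by exact: leq_trans mN.
have kN : ((N + N).-1 < N + N)%N by rewrite prednK// addn_gt0 N0.
apply: le_trans (hk N _ x kN _); last by rewrite vE ltry.
have -> : (2 * t N (N + N).-1 = 2 ^+ N)%R.
  by rewrite /t mulrCA -exprS prednK ?addn_gt0 ?N0// exprD mulKf// expf_neq0.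
rewrite lee_fin; apply: (@le_trans _ _ (2 ^+ N)%R); last first.
  by apply: le1r_powR; [rewrite exprn_ege1// ler1n|exact: ltW].
apply/ltW/(lt_trans (truncnS_gt _)); rewrite -natrX ltr_nat.
exact: leq_ltn_trans mN (ltn_expl _ _).
Qed.

End strong_type.

(** * The strong type estimate for the fractional maximal function *)

Section fractional.
Context {R : realType} (G : stratifiedGroup R).
Local Notation T := (borelType G).
Variable mu : {measure set T -> \bar R}.
Variables (rho : G -> R) (hrho : homogeneous_norm rho).
Local Notation mball := (gball_measurable hrho).
Local Notation Q := (hom_dim G).
Local Notation M alpha f := (frac_maximal mu rho alpha f).
Variables (c1 : R) (c1_gt0 : 0 < c1).
Local Notation vol r := (c1 * r ^+ Q).
Hypothesis hvol : forall (x : G) (r : R), 0 < r -> mu (gball rho x r) = (vol r)%:E.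

Local Open Scope ereal_scope.

(** Hedberg's argument: the average of order gamma over a ball of volume V is
    V^(gamma/Q) u, where u is the mean of |f|; as u <= 2 A V^(-1/p), raising this
    bound to the power th = p gamma / Q cancels the volume and leaves the power
    p / q of u, which is at most that of the maximal function of order 0. *)
Lemma frac_maximal_strong_type (gamma p q : R) :
  (0 < Q)%N -> (0 <= gamma)%R -> (1 < p)%R -> (0 < q)%R ->
  (q^-1 = p^-1 - gamma / Q%:R)%R ->
  exists2 C : R, (0 < C)%R & forall (f : T -> R) (A : R),
    measurable_fun setT f -> (0 < A)%R ->
    \int[mu]_x (`|f x| `^ p)%:E <= (A `^ p)%:E ->
    \int[mu]_x (M gamma f x `^ q) <= ((C * A) `^ q)%:E.
Proof.
move=> Q0 g0 p1 q0 pq.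
have Q0' : (Q%:R != 0 :> R)%R by rewrite pnatr_eq0 -lt0n.
have p0 : (0 < p)%R by rewrite (lt_trans ltr01).
have pn0 : p != 0%R by rewrite gt_eqF.
have qn0 : q != 0%R by rewrite gt_eqF.
have [C0 C00 hC0] := maximal_strong_type hrho c1_gt0 hvol p1.
pose th := (p * (gamma / Q%:R))%R.
have th0 : (0 <= th)%R by rewrite mulr_ge0 ?divr_ge0// ltW.
have thpq : (th + p / q = 1)%R by rewrite pq /th mulrBr mulfV// addrC subrK.
have thq : (th * q + p = q)%R.
  by rewrite -[X in (_ + X)%R](divfK qn0) -mulrDl thpq mul1r.
have C10 : (0 < C0 + 1)%R by rewrite ltr_wpDl.
exists (2 `^ th * (C0 + 1) `^ q^-1)%R; first by rewrite mulr_gt0 ?powR_gt0.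
move=> f A mf A0 hf.
have A20 : (0 < 2 * A)%R by rewrite mulr_gt0.
have pointwise x : M gamma f x <= ((2 * A) `^ th)%:E * (M 0 f x `^ (p / q)).
  apply: frac_maximal_le => c r r0 xB.
  have V0 : (0 < vol r)%R by exact: vol_gt0.
  have mnf : measurable_fun setT (fun x : T => `|f x|%R) by exact: measurableT_comp.
  (* The power mean of |f| over the ball is at most L. *)
  pose L := (A * vol r `^ (- p^-1))%R.
  have L0 : (0 < L)%R by rewrite mulr_gt0 ?powR_gt0.
  have IL : \int[mu]_(y in gball rho c r) `|f y|%:E <= (2 * L * vol r)%:E.
    apply: (integral_le_of_power (s := p)) => //.
    - exact: mball.
    - exact: hvol.
    - exact: measurable_funS mnf.
    - exact: ltW.
    rewrite /L powRM ?powR_ge0 ?(ltW A0)// -powRrM mulNr mulVf//.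
    rewrite powR_inv1 ?(ltW V0)// divfK ?gt_eqF//.
    apply: le_trans hf; apply: ge0_subset_integral => //; first exact: mball.
    by apply/measurable_EFinP; exact: (measurableT_comp (measurable_powR _)).
  have := frac_average_le mu 0 f r0 xB.
  rewrite !(frac_averageE c1_gt0 hvol)// mul0r sub0r.
  have I0 : 0 <= \int[mu]_(y in gball rho c r) `|f y|%:E.
    by apply: integral_ge0 => y _; rewrite lee_fin.
  move: IL I0; case: (\int[mu]_(y in gball rho c r) `|f y|%:E) => [i| |]// .
  rewrite !lee_fin => iL i0; rewrite powR_inv1 ?(ltW V0)// -!EFinM => uM.
  set V := vol r in V0 iL uM *.
  pose u := (i / V)%R.
  have u0 : (0 <= u)%R by rewrite divr_ge0// ltW.
  have uL : (u <= 2 * L)%R by rewrite ler_pdivrMr.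
  apply: (@le_trans _ _ (((2 * A) `^ th)%:E * (u%:E `^ (p / q)))); last first.
    apply: lee_wpmul2l; first by rewrite lee_fin powR_ge0.
    apply: gt0_ler_poweR.
    - by rewrite divr_ge0 ?ltW.
    - by rewrite in_itv/= leey andbT lee_fin.
    - by rewrite in_itv/= leey andbT (frac_maximal_ge0 hrho c1_gt0 hvol).
    - by rewrite /u mulrC.
  rewrite poweR_EFin -EFinM lee_fin.
  have -> : (V `^ (gamma / Q%:R - 1) * i = V `^ (gamma / Q%:R) * u)%R.
    rewrite powRD; last by apply/implyP => _; rewrite gt_eqF.
    by rewrite powR_inv1 ?(ltW V0)// /u mulrAC mulrA.
  have {1}-> : (u = u `^ th * u `^ (p / q))%R.
    by rewrite -powRD ?thpq ?powRr1// oner_eq0.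
  rewrite mulrA; apply: ler_wpM2r; first exact: powR_ge0.
  apply: (@le_trans _ _ (V `^ (gamma / Q%:R) * (2 * L) `^ th)%R).
    apply: ler_wpM2l; first exact: powR_ge0.
    by apply: ge0_ler_powR; rewrite ?nnegrE// mulr_ge0// ltW.
  rewrite /L -/V mulrA powRM ?powR_ge0 ?(ltW A20)// -powRrM mulrCA.
  have -> : (- p^-1 * th = - (gamma / Q%:R))%R by rewrite /th mulNr mulKf.
  by rewrite powRN mulfV ?mulr1// gt_eqF// powR_gt0.
have mM g : measurable_fun (setT : set T) (M g f) by exact: measurable_frac_maximal.
apply: (@le_trans _ _ (\int[mu]_x (((2 * A) `^ (th * q))%:E * (M 0 f x `^ p)))).
  apply: ge0_le_integral => //.
  - by move=> x _; exact: poweR_ge0.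
  - exact: (measurableT_comp (measurable_poweR _)).
  - by apply: measurable_funeM; exact: (measurableT_comp (measurable_poweR _)).
  move=> x _; apply: (@le_trans _ _ ((((2 * A) `^ th)%:E * (M 0 f x `^ (p / q))) `^ q)).
    have M0 g := frac_maximal_ge0 hrho c1_gt0 hvol g f x.
    apply: gt0_ler_poweR => //; rewrite ?in_itv/= ?leey ?andbT ?M0//.
      exact: ltW.
    by rewrite mule_ge0 ?poweR_ge0// lee_fin powR_ge0.
  rewrite poweRM ?poweR_ge0 ?lee_fin ?powR_ge0//.
  by rewrite -poweRrM divfK// poweR_EFin -powRrM.
rewrite ge0_integralZl_EFin ?powR_ge0//; last 2 first.
- by move=> x _; exact: poweR_ge0.
- exact: (measurableT_comp (measurable_poweR _)).
apply: (@le_trans _ _ (((2 * A) `^ (th * q))%:E * (C0%:E * (A `^ p)%:E))).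
  apply: lee_wpmul2l; first by rewrite lee_fin powR_ge0.
  by apply: le_trans (hC0 f mf) _; apply: lee_wpmul2l.
rewrite -!EFinM lee_fin.
rewrite !powRM ?powR_ge0 ?mulr_ge0 ?powR_ge0 ?(ltW A0)//.
rewrite -!powRrM mulVf// powRr1 ?(ltW C10)//.
have -> : (A `^ q = A `^ (th * q) * A `^ p)%R.
  by rewrite -powRD ?thq//; apply/implyP => _; rewrite gt_eqF.
rewrite [leLHS](_ : _ = 2 `^ (th * q) * C0 * (A `^ (th * q) * A `^ p))%R; last by ring.
apply: ler_wpM2r; first by rewrite mulr_ge0 ?powR_ge0.
by apply: ler_wpM2l; rewrite ?powR_ge0// lerDl.
Qed.

(** Stating the bounds with a positive A above the L^p norm avoids a case
    distinction when the norm vanishes. *)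
Lemma bounded_Lp_Lq_of_integral (S : (G -> R) -> G -> \bar R) (p q C : R) :
  (0 < p)%R -> (0 < q)%R -> (0 < C)%R ->
  (forall (f : T -> R) (A : R), measurable_fun setT f -> (0 < A)%R ->
    \int[mu]_x (`|f x| `^ p)%:E <= (A `^ p)%:E ->
    \int[mu]_x (`|S f x| `^ q) <= ((C * A) `^ q)%:E) ->
  bounded_Lp_Lq mu S p q.
Proof.
move=> p0 q0 C0 hS; exists C => // f mf hN.
have pn0 : p != 0%R by rewrite gt_eqF.
have pE := @powR_Lnorm _ _ _ mu (EFin \o f) p pn0.
have N0 := Lnorm_ge0 mu p%:E (EFin \o f).
move: hN N0 pE; case: ('N[mu]_p%:E[EFin \o f]) => [a| |]// _.
rewrite lee_fin => a0 pE.
rewrite -EFinM; apply/lee_addgt0Pr => e e0; rewrite -EFinD.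
have A0 : (0 < a + e / C)%R by rewrite ltr_wpDl// divr_gt0.
have hA : (C * (a + e / C) = C * a + e)%R by rewrite mulrDr mulrCA mulfV ?mulr1// gt_eqF.
have : \int[mu]_x (`|S f x| `^ q) <= ((C * (a + e / C)) `^ q)%:E.
  apply: hS => //; rewrite -[leLHS]pE poweR_EFin lee_fin.
  apply: ge0_ler_powR; rewrite ?nnegrE ?(ltW p0) ?(ltW A0)//.
  by rewrite lerDl divr_ge0// ltW.
rewrite unlock hA => hI.
have CA0 : (0 <= C * a + e)%R by rewrite -hA mulr_ge0// ltW.
have -> : (C * a + e)%:E = ((C * a + e) `^ q)%:E `^ q^-1.
  by rewrite poweR_EFin -powRrM mulfV ?gt_eqF// powRr1.
apply: gt0_ler_poweR => //.
- by rewrite invr_ge0 ltW.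
- by rewrite in_itv/= leey andbT integral_ge0// => x _; exact: poweR_ge0.
- by rewrite in_itv/= leey andbT lee_fin powR_ge0.
Qed.

End fractional.

(** * Nonnegative Lipschitz functions: boundedness and oscillation *)

Section lipschitz.
Context {R : realType} (G : stratifiedGroup R).
Local Notation T := (borelType G).
Variable mu : {measure set T -> \bar R}.
Variables (rho : G -> R) (hrho : homogeneous_norm rho).
Local Notation mball := (gball_measurable hrho).
Local Notation Q := (hom_dim G).
Local Notation M alpha f := (frac_maximal mu rho alpha f).
Variables (c1 : R) (c1_gt0 : 0 < c1).
Local Notation vol r := (c1 * r ^+ Q).
Hypothesis hvol : forall (x : G) (r : R), 0 < r -> mu (gball rho x r) = (vol r)%:E.
Hypothesis Q_gt0 : (0 < Q)%N.

Lemma vol_powR (beta r : R) : 0 < r ->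
  vol r `^ (beta / Q%:R) = c1 `^ (beta / Q%:R) * r `^ beta.
Proof.
move=> r0; rewrite powRM ?exprn_ge0 ?ltW// -powR_mulrn ?ltW// -powRrM.
by rewrite mulrCA mulfV ?mulr1// pnatr_eq0 -lt0n.
Qed.

Lemma Lambda_continuous beta (b : G -> R) : 0 < beta -> Lambda rho beta b ->
  continuous b.
Proof.
move=> beta0 [C C0 hC] x; apply/cvgrPdist_lt => e e0.
have d0 : 0 < (e / C) `^ beta^-1 by rewrite powR_gt0// divr_gt0.
apply: filterS (open_nbhs_nbhs (conj (gball_open hrho x _) (gball_center hrho x d0))).
move=> y /= yB; apply: (le_lt_trans (hC x y)).
rewrite mulrC -ltr_pdivlMr//.
have -> : e / C = ((e / C) `^ beta^-1) `^ beta.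
  by rewrite -powRrM mulVf ?gt_eqF// powRr1// divr_ge0 ?ltW.
by apply: gt0_ltr_powR; rewrite ?nnegrE ?(hnorm_ge0 hrho) ?powR_ge0.
Qed.

Lemma Lambda_gball beta (b : G -> R) : 0 < beta -> Lambda rho beta b ->
  exists2 K, 0 < K & forall c r x y, 0 < r -> gball rho c r x -> gball rho c r y ->
    `|b x - b y| <= K * r `^ beta.
Proof.
move=> beta0 [C C0 hC]; have [c0 c01 hM] := hnormM hrho.
have c00 : 0 < c0 by rewrite (lt_le_trans ltr01).
exists (C * (2 * c0) `^ beta); first by rewrite mulr_gt0 ?powR_gt0 ?mulr_gt0.
move=> c r x y r0 xB yB; apply: (le_trans (hC x y)); rewrite -mulrA ler_pM2l//.
rewrite -powRM ?mulr_ge0 ?(ltW c00) ?(ltW r0)//.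
apply: ge0_ler_powR; rewrite ?nnegrE ?(hnorm_ge0 hrho) ?mulr_ge0 ?(ltW c00) ?(ltW r0) ?(ltW beta0)//.
apply: (le_trans (rho_triangle hM x c y)); rewrite (rho_sym hrho x c).
rewrite [leRHS](_ : _ = c0 * (r + r)); last by ring.
by rewrite ler_pM2l//; apply: lerD; exact: ltW.
Qed.

Local Open Scope ereal_scope.

Lemma frac_average_ae alpha (f g : T -> R) c r :
  measurable_fun setT f -> measurable_fun setT g -> {ae mu, forall x, f x = g x} ->
  frac_average mu rho alpha f c r = frac_average mu rho alpha g c r.
Proof.
move=> mf mg fg; congr (_ * _); apply: ge0_ae_eq_integral.
- exact: mball.
- by apply/measurable_EFinP; apply: measurableT_comp => //; exact: measurable_funS mf.
- by apply/measurable_EFinP; apply: measurableT_comp => //; exact: measurable_funS mg.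
- by move=> x _; rewrite lee_fin.
- by move=> x _; rewrite lee_fin.
- by apply: filterS fg => x -> _.
Qed.

Lemma frac_maximal_ae alpha (f g : T -> R) :
  measurable_fun setT f -> measurable_fun setT g -> {ae mu, forall x, f x = g x} ->
  M alpha f = M alpha g.
Proof.
move=> mf mg fg; apply/funext => x; congr ereal_sup.
apply/seteqP; split => z [c [r [r0 xB ->]]]; exists c, r; split => //.
  exact: frac_average_ae.
exact/esym/frac_average_ae.
Qed.

Lemma frac_maximal_in_ae alpha B (f g : T -> R) :
  measurable_fun setT f -> measurable_fun setT g -> {ae mu, forall x, f x = g x} ->
  frac_maximal_in mu rho alpha B f = frac_maximal_in mu rho alpha B g.
Proof.
move=> mf mg fg; apply/funext => x; congr ereal_sup.
apply/seteqP; split => z [c [r [r0 xB BB ->]]]; exists c, r; split => //.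
  exact: frac_average_ae.
exact/esym/frac_average_ae.
Qed.

Lemma measurable_max_commutator alpha (b f : T -> R) : measurable_fun setT b ->
  measurable_fun (setT : set T) (max_commutator mu rho b alpha f).
Proof.
move=> mb; apply: emeasurable_funB; last exact: measurable_frac_maximal.
by apply: emeasurable_funM; [exact/measurable_EFinP|exact: measurable_frac_maximal].
Qed.

Section nonneg.
Variables (beta : R) (b : G -> R).
Hypotheses (beta_gt0 : (0 < beta)%R) (b_ge0 : forall x, (0 <= b x)%R).
Hypothesis bLambda : Lambda rho beta b.

Let mb : measurable_fun (setT : set T) b.
Proof. exact: continuous_borel (Lambda_continuous beta_gt0 bLambda). Qed.

(** Both inequalities are proved on each ball that contains x, where b differs
    from b x by a multiple of r^beta, and then passed to the supremum. The
    finiteness of M alpha f x gives a meaning to the difference. *)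
Lemma commutator_le : exists2 K, (0 < K)%R & forall alpha (f : T -> R) x,
  measurable_fun setT f -> M alpha f x \is a fin_num ->
  `|max_commutator mu rho b alpha f x| <= K%:E * M (alpha + beta) f x.
Proof.
have [K0 K00 hK] := Lambda_gball beta_gt0 bLambda.
pose e := (c1 `^ (beta / Q%:R))%R.
have e0 : (0 < e)%R by exact: powR_gt0.
exists (K0 / e)%R; first by rewrite divr_gt0.
move=> alpha f x mf Mfin.
have mnf : measurable_fun setT (fun x : T => `|f x|%R) by exact: measurableT_comp.
have mbf : measurable_fun setT (fun x : T => `|b x * f x|%R).
  by apply: measurableT_comp => //; exact: measurable_funM.
have M0 a (g : G -> R) := frac_maximal_ge0 hrho c1_gt0 hvol a g x.
have KM0 : 0 <= (K0 / e)%:E * M (alpha + beta) f x.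
  by rewrite mule_ge0 ?M0// lee_fin divr_ge0// ltW.
have onball c r : (0 < r)%R -> gball rho c r x ->
   (frac_average mu rho alpha (fun y => b y * f y)%R c r <=
     (b x)%:E * frac_average mu rho alpha f c r + (K0 / e)%:E * M (alpha + beta) f x) /\
   ((b x)%:E * frac_average mu rho alpha f c r <=
     frac_average mu rho alpha (fun y => b y * f y)%R c r + (K0 / e)%:E * M (alpha + beta) f x).
  move=> r0 xB.
  have V0 : (0 < vol r)%R by exact: vol_gt0.
  set V := vol r in V0.
  set I := \int[mu]_(y in gball rho c r) `|f y|%:E.
  set J := \int[mu]_(y in gball rho c r) `|(b y * f y)%R|%:E.
  have I0 : 0 <= I by apply: integral_ge0 => y _; rewrite lee_fin.
  have avg : (V `^ (alpha / Q%:R - 1) * (K0 * r `^ beta))%:E * I <= (K0 / e)%:E * M (alpha + beta) f x.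
    apply: (@le_trans _ _ ((K0 / e)%:E * frac_average mu rho (alpha + beta) f c r)); last first.
      by apply: lee_wpmul2l; [rewrite lee_fin divr_ge0// ltW|exact: frac_average_le].
    rewrite (frac_averageE c1_gt0 hvol)// -/I -/V muleA -EFinM.
    rewrite le_eqVlt; apply/orP; left; apply/eqP; congr (_%:E * _).
    rewrite [in RHS]mulrDl addrAC [in RHS]powRD; last by apply/implyP => _; rewrite gt_eqF.
    rewrite {3}/V vol_powR// -/e; field; exact: lt0r_neq0.
  have hJ : J <= (b x + K0 * r `^ beta)%:E * I.
    rewrite -ge0_integralZl_EFin//; last 3 first.
    - exact: mball.
    - by apply/measurable_EFinP; exact: measurable_funS mnf.
    - by rewrite addr_ge0// mulr_ge0 ?powR_ge0// ltW.
    apply: ge0_le_integral => //.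
    - exact: mball.
    - by apply/measurable_EFinP; exact: measurable_funS mbf.
    - by apply: measurable_funeM; apply/measurable_EFinP; exact: measurable_funS mnf.
    move=> y yB; rewrite -EFinM lee_fin normrM ler_wpM2r// ger0_norm//.
    by have [] := dist_le (hK c r y x r0 yB xB).
  have hI : (b x)%:E * I <= J + (K0 * r `^ beta)%:E * I.
    rewrite -!ge0_integralZl_EFin//; last 5 first.
    - exact: mball.
    - by apply/measurable_EFinP; exact: measurable_funS mnf.
    - by rewrite mulr_ge0 ?powR_ge0// ltW.
    - exact: mball.
    - by apply/measurable_EFinP; exact: measurable_funS mnf.
    rewrite -ge0_integralD//; last 4 first.
    - exact: mball.
    - by apply/measurable_EFinP; exact: measurable_funS mbf.
    - by move=> y _; rewrite -EFinM lee_fin mulr_ge0// mulr_ge0 ?powR_ge0// ltW.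
    - by apply: measurable_funeM; apply/measurable_EFinP; exact: measurable_funS mnf.
    apply: ge0_le_integral => //.
    - exact: mball.
    - by move=> y _; rewrite -EFinM lee_fin mulr_ge0.
    - by apply: measurable_funeM; apply/measurable_EFinP; exact: measurable_funS mnf.
    - apply: emeasurable_funD; first by apply/measurable_EFinP; exact: measurable_funS mbf.
      by apply: measurable_funeM; apply/measurable_EFinP; exact: measurable_funS mnf.
    move=> y yB; rewrite -!EFinM -EFinD lee_fin normrM (ger0_norm (b_ge0 y)) -mulrDl.
    rewrite ler_wpM2r//.
    by have [] := dist_le (hK c r y x r0 yB xB).
  have Vp : 0 <= (V `^ (alpha / Q%:R - 1))%:E by rewrite lee_fin powR_ge0.
  rewrite !(frac_averageE c1_gt0 hvol)// -/I -/J -/V; split.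
    apply: (@le_trans _ _ ((V `^ (alpha / Q%:R - 1))%:E * ((b x)%:E * I + (K0 * r `^ beta)%:E * I))).
      apply: lee_wpmul2l => //; rewrite -ge0_muleDl ?lee_fin//.
      by rewrite mulr_ge0 ?powR_ge0// ltW.
    rewrite ge0_muleDr; last 2 first.
    - by rewrite mule_ge0// lee_fin.
    - by rewrite mule_ge0// lee_fin mulr_ge0 ?powR_ge0// ltW.
    by rewrite muleCA; apply: leeD2l; rewrite muleA -EFinM.
  rewrite muleCA; apply: (@le_trans _ _ ((V `^ (alpha / Q%:R - 1))%:E * (J + (K0 * r `^ beta)%:E * I))).
    exact: lee_wpmul2l.
  rewrite ge0_muleDr; last 2 first.
  - by apply: integral_ge0 => y _; rewrite lee_fin.
  - by rewrite mule_ge0// lee_fin mulr_ge0 ?powR_ge0// ltW.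
  by apply: leeD2l; rewrite muleA -EFinM.
apply: abse_sub_le => //.
- by rewrite fin_numM.
- have [->|bx0] := eqVneq (b x) 0%R; first by rewrite mul0e adde_ge0.
  have bxp : (0 < b x)%R by rewrite lt_def bx0 b_ge0.
  rewrite -lee_pdivlMl//; apply: frac_maximal_le => c r r0 xB.
  rewrite lee_pdivlMl//; have [_ h] := onball c r r0 xB.
  by apply: le_trans h _; apply: leeD2r; exact: frac_average_le.
- apply: frac_maximal_le => c r r0 xB; have [h _] := onball c r r0 xB.
  apply: le_trans h _; apply: leeD2r; apply: lee_wpmul2l; first by rewrite lee_fin.
  exact: frac_average_le.
Qed.

(** The ball itself gives the lower bound; the upper bound holds on each
    smaller ball since its volume is smaller and its points are in the larger
    one. *)
Lemma maximal_in_close : exists2 K, (0 < K)%R & forall alpha c r x, (0 <= alpha)%R ->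
  (0 < r)%R -> gball rho c r x ->
  `| (b x)%:E - (vol r `^ (- (alpha / Q%:R)))%:E *
      frac_maximal_in mu rho alpha (gball rho c r) b x | <= (K * r `^ beta)%:E.
Proof.
have [K K0 hK] := Lambda_gball beta_gt0 bLambda.
exists K => // alpha c r x a0 r0 xB.
set k := (K * r `^ beta)%R.
have k0 : (0 <= k)%R by rewrite mulr_ge0 ?powR_ge0// ltW.
have V0 : (0 < vol r)%R by exact: vol_gt0.
have mnb : measurable_fun setT (fun x : T => `|b x|%R) by exact: measurableT_comp.
set Mi := frac_maximal_in _ _ _ _ _ _.
have up : Mi <= (vol r `^ (alpha / Q%:R) * (b x + k))%:E.
  apply: ge_ereal_sup => _ [c' [r' [r'0 xB' sub ->]]].
  have V'0 : (0 < vol r')%R by exact: vol_gt0.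
  have V'V : (vol r' <= vol r)%R.
    rewrite -lee_fin -(hvol c' r'0) -(hvol c r0); apply: le_measure => //;
      by rewrite inE; exact: mball.
  rewrite (frac_averageE c1_gt0 hvol)//.
  apply: (@le_trans _ _ ((vol r' `^ (alpha / Q%:R - 1))%:E * ((b x + k) * vol r')%:E)).
    apply: lee_wpmul2l; first by rewrite lee_fin powR_ge0.
    rewrite EFinM -(hvol c' r'0) -integral_cst; last exact: mball.
    apply: ge0_le_integral => //.
    - exact: mball.
    - by apply/measurable_EFinP; exact: measurable_funS mnb.
    move=> y yB' /=; rewrite lee_fin ger0_norm//.
    by have [] := dist_le (hK c r y x r0 (sub _ yB') xB).
  rewrite -EFinM lee_fin mulrCA [leLHS]mulrC.
  apply: ler_wpM2r; first by rewrite addr_ge0.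
  rewrite -{2}(powRr1 (ltW V'0)) -powRD ?subrK; last by apply/implyP => _; rewrite gt_eqF.
  apply: ge0_ler_powR; rewrite ?nnegrE ?(ltW V0) ?(ltW V'0) ?V'V//.
  by rewrite divr_ge0.
have lo : (vol r `^ (alpha / Q%:R) * Num.max 0 (b x - k))%:E <= Mi.
  apply: (@le_trans _ _ (frac_average mu rho alpha b c r)); last first.
    by apply: ereal_sup_ubound; exists c, r; split.
  rewrite (frac_averageE c1_gt0 hvol)//.
  apply: (@le_trans _ _ ((vol r `^ (alpha / Q%:R - 1))%:E * (Num.max 0 (b x - k) * vol r)%:E)).
    rewrite -EFinM lee_fin [leRHS]mulrCA [leRHS]mulrC.
    apply: ler_wpM2r; first by rewrite le_max lexx.
    rewrite -{3}(powRr1 (ltW V0)) -powRD ?subrK//.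
    by apply/implyP => _; rewrite gt_eqF.
  apply: lee_wpmul2l; first by rewrite lee_fin powR_ge0.
  rewrite EFinM -(hvol c r0) -integral_cst; last exact: mball.
  apply: ge0_le_integral => //.
  - exact: mball.
  - by move=> y _ /=; rewrite lee_fin le_max lexx.
  - by apply/measurable_EFinP; exact: measurable_funS mnb.
  move=> y yB /=; rewrite lee_fin ger0_norm// ge_max b_ge0/=.
  by rewrite lerBlDr; have [] := dist_le (hK c r y x r0 yB xB).
have m0 : (0 <= Num.max 0 (b x - k))%R by rewrite le_max lexx.
have mb' : (b x - k <= Num.max 0 (b x - k))%R by rewrite le_max lexx orbT.
move: lo up; case: Mi => // m; rewrite !lee_fin => lo up.
rewrite powRN.
set W := (vol r `^ (alpha / Q%:R))%R in lo up *.
have W0 : (0 < W)%R by exact: powR_gt0.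
have : (W^-1 * m <= b x + k)%R by rewrite mulrC ler_pdivrMr// mulrC.
have : (Num.max 0 (b x - k) <= W^-1 * m)%R by rewrite mulrC ler_pdivlMr// mulrC.
by move=> h1 h2; exact: le_dist mb' h1 h2.
Qed.

End nonneg.

Variables (alpha beta : R).
Hypotheses (alpha_gt0 : (0 < alpha)%R) (beta_gt0 : (0 < beta)%R).
Variables (b b' : T -> R).
Hypotheses (mb : measurable_fun setT b) (bb' : {ae mu, forall x, b x = b' x}).
Hypotheses (b'Lambda : Lambda rho beta b') (b'_ge0 : forall x, (0 <= b' x)%R).

Let mb' : measurable_fun (setT : set T) b'.
Proof. exact: continuous_borel (Lambda_continuous beta_gt0 b'Lambda). Qed.

Theorem commutator_bounded (p q : R) : (1 < p)%R -> (p < Q%:R / (alpha + beta))%R ->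
  (q^-1 = p^-1 - (alpha + beta) / Q%:R)%R ->
  bounded_Lp_Lq mu (max_commutator mu rho b alpha) p q.
Proof.
move=> p1 pQ pq.
have p0 : (0 < p)%R by rewrite (lt_trans ltr01).
have ab0 : (0 < alpha + beta)%R by rewrite addr_gt0.
have Q0 : (0 < Q%:R :> R)%R by rewrite ltr0n.
have abp : ((alpha + beta) / Q%:R < p^-1)%R.
  by rewrite ltr_pdivrMr// mulrC ltr_pdivlMr// mulrC -ltr_pdivlMr.
have q0 : (0 < q)%R by rewrite -invr_gt0 pq subr_gt0.
(* M_alpha maps L^p to L^q1, and so is finite almost everywhere on L^p. *)
pose q1 := (p^-1 - alpha / Q%:R)^-1%R.
have q10 : (0 < q1)%R.
  rewrite invr_gt0 subr_gt0; apply: le_lt_trans abp.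
  by rewrite ler_pM2r ?invr_gt0// lerDl ltW.
have [C1 C10 hC1] := frac_maximal_strong_type hrho c1_gt0 hvol Q_gt0 (ltW alpha_gt0)
  p1 q10 (invrK _).
have [C2 C20 hC2] := frac_maximal_strong_type hrho c1_gt0 hvol Q_gt0 (ltW ab0) p1 q0 pq.
have [K K0 hK] := commutator_le beta_gt0 b'_ge0 b'Lambda.
apply: (@bounded_Lp_Lq_of_integral _ _ _ _ _ _ (K * C2)%R) => //; first by rewrite mulr_gt0.
move=> f A mf A0 hf.
have mM a (g : T -> R) : measurable_fun (setT : set T) (M a g) by exact: measurable_frac_maximal.
have M0 a (g : T -> R) x := frac_maximal_ge0 hrho c1_gt0 hvol a g x.
have Mfin : {ae mu, forall x, M alpha f x \is a fin_num}.
  have int : mu.-integrable (setT : set T) (fun x => M alpha f x `^ q1).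
    apply/integrableP; split; first exact: (measurableT_comp (measurable_poweR _)).
    under eq_integral do rewrite gee0_abs ?poweR_ge0//.
    by apply: le_lt_trans (hC1 f A mf A0 hf) _; exact: ltry.
  apply: filterS (integrable_ae measurableT int) => x /(_ I).
  rewrite !ge0_fin_numE ?poweR_ge0 ?M0//; apply: lty_poweRy.
  by rewrite gt_eqF.
have mbf (g : T -> R) : measurable_fun setT g -> measurable_fun setT (fun x => g x * f x)%R.
  by move=> mg; exact: measurable_funM.
have Mbb' : M alpha (fun x => b x * f x)%R = M alpha (fun x => b' x * f x)%R.
  by apply: frac_maximal_ae; [exact: mbf|exact: mbf|apply: filterS bb' => x ->].
apply: (@le_trans _ _ (\int[mu]_x ((K%:E * M (alpha + beta) f x) `^ q))).
  apply: ae_ge0_le_integral => //.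
  - by move=> x _; exact: poweR_ge0.
  - apply: (measurableT_comp (measurable_poweR _)); apply: measurableT_comp => //.
    exact: measurable_max_commutator.
  - by move=> x _; exact: poweR_ge0.
  - by apply: (measurableT_comp (measurable_poweR _)); exact: measurable_funeM.
  move: bb' Mfin; apply: filterS2 => x bx fx _.
  apply: gt0_ler_poweR; rewrite ?in_itv/= ?leey ?andbT ?(ltW q0) ?mule_ge0 ?M0 ?lee_fin ?(ltW K0)//.
  have := hK alpha f x mf fx.
  by rewrite /max_commutator bx Mbb'.
under eq_integral do rewrite poweRM ?M0 ?lee_fin ?(ltW K0)// poweR_EFin.
rewrite ge0_integralZl_EFin ?powR_ge0//; last 2 first.
- by move=> x _; exact: poweR_ge0.
- exact: (measurableT_comp (measurable_poweR _)).
apply: (@le_trans _ _ ((K `^ q)%:E * ((C2 * A) `^ q)%:E)).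
  by apply: lee_wpmul2l; [rewrite lee_fin powR_ge0|exact: hC2].
by rewrite -EFinM -powRM ?mulr_ge0 ?(ltW K0) ?(ltW C20) ?(ltW A0)// mulrA.
Qed.

Theorem oscillation_bounded_Lambda (s : R) : (1 <= s)%R ->
  oscillation_bounded mu rho b alpha beta s.
Proof.
move=> s1; have s0 : (0 < s)%R by rewrite (lt_le_trans ltr01).
have [K K0 hK] := maximal_in_close beta_gt0 b'_ge0 b'Lambda.
pose e := (c1 `^ (beta / Q%:R))%R.
have e0 : (0 < e)%R by exact: powR_gt0.
apply: (@le_lt_trans _ _ (K / e)%:E); last exact: ltry.
apply: ge_ereal_sup => _ [c [r [r0 ->]]].
have V0 : (0 < vol r)%R by exact: vol_gt0.
have rb0 : (0 < r `^ beta)%R by exact: powR_gt0.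
rewrite /oscillation hvol// !poweR_EFin !inver !gt_eqF ?powR_gt0//.
have I : \int[mu]_(x in gball rho c r) `| (b x)%:E - (vol r `^ (- (alpha / Q%:R)))%:E *
   frac_maximal_in mu rho alpha (gball rho c r) b x | `^ s <= ((K * r `^ beta) `^ s)%:E * (vol r)%:E.
  rewrite -(hvol c r0) -integral_cst; last exact: mball.
  apply: ae_ge0_le_integral => //.
  - exact: mball.
  - by move=> x _; exact: poweR_ge0.
  - apply: (measurableT_comp (measurable_poweR _)); apply: measurableT_comp => //.
    apply: emeasurable_funB; first by apply/measurable_EFinP; exact: measurable_funS mb.
    apply: measurable_funeM; apply: measurable_funS measurableT (@subsetT _ _) _.
    exact: measurable_frac_maximal_in.
  - by move=> x _ /=; rewrite lee_fin powR_ge0.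
  apply: filterS bb' => x bx xB /=; rewrite -[leRHS]poweR_EFin.
  apply: gt0_ler_poweR; rewrite ?in_itv/= ?leey ?andbT ?(ltW s0) ?abse_ge0// ?lee_fin ?mulr_ge0 ?(ltW K0) ?(ltW rb0)//.
  rewrite (frac_maximal_in_ae alpha _ mb mb' bb') bx.
  exact: hK (ltW alpha_gt0) r0 xB.
apply: (@le_trans _ _ ((vol r `^ (beta / Q%:R))^-1%:E * (((K * r `^ beta) `^ s)%:E `^ s^-1))).
  apply: lee_wpmul2l; first by rewrite lee_fin invr_ge0 powR_ge0.
  apply: gt0_ler_poweR.
  - by rewrite invr_ge0 ltW.
  - rewrite in_itv/= leey andbT mule_ge0 ?lee_fin ?invr_ge0 ?(ltW V0)//.
    by apply: integral_ge0 => x _; exact: poweR_ge0.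
  - by rewrite in_itv/= leey andbT lee_fin powR_ge0.
  apply: (@le_trans _ _ ((vol r)^-1%:E * (((K * r `^ beta) `^ s)%:E * (vol r)%:E))).
    by apply: lee_wpmul2l => //; rewrite lee_fin invr_ge0 ltW.
  by rewrite -!EFinM lee_fin mulrC mulfK// gt_eqF.
rewrite poweR_EFin -powRrM mulfV ?gt_eqF// powRr1 ?mulr_ge0 ?(ltW K0) ?(ltW rb0)//.
rewrite vol_powR// -/e -EFinM lee_fin invfM.
rewrite [leLHS](_ : _ = K / e * (r `^ beta / r `^ beta))%R; last by ring.
by rewrite mulfV ?gt_eqF// mulr1.
Qed.

End lipschitz.

(** * From decay of the deficit to a Lipschitz representative *)

Section campanato.
Context {R : realType} (G : stratifiedGroup R).
Local Notation T := (borelType G).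
Variable mu : {measure set T -> \bar R}.
Hypothesis hmu : biinvariant_haar mu.
Variables (rho : G -> R) (hrho : homogeneous_norm rho).
Local Notation mball := (gball_measurable hrho).
Local Notation Q := (hom_dim G).
Variables (c1 : R) (c1_gt0 : 0 < c1).
Local Notation vol r := (c1 * r ^+ Q).
Hypothesis hvol : forall (x : G) (r : R), 0 < r -> mu (gball rho x r) = (vol r)%:E.
Variables (b : T -> R) (hb : loc_integrable mu b).
Local Notation ball := (gball rho).
Local Notation integ c r f := (mu.-integrable (ball c r) (EFin \o f)).

Lemma inv_vol_ge0 r : 0 < r -> 0 <= (vol r)^-1.
Proof. by move=> r0; rewrite invr_ge0 ltW// vol_gt0. Qed.

Definition mean (f : T -> R) (c : G) (r : R) : R :=
  (vol r)^-1 * \int[mu]_(x in ball c r) f x.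

Lemma ball_lty c r : (mu (ball c r) < +oo)%E.
Proof.
have [r0|r0] := ltP 0 r; first by rewrite hvol// ltry.
suff -> : ball c r = set0 by rewrite measure0 ltry.
rewrite -subset0 => y; rewrite /gball /= ltNge => /negP; apply.
by rewrite (le_trans r0)// (hnorm_ge0 hrho).
Qed.

Lemma integ_b c r : integ c r b.
Proof.
apply: loc_integrable_gball => // s s0; exact: ball_lty.
Qed.

Lemma integ_cst c r k : integ c r (cst k).
Proof.
apply: measurable_bounded_integrable; [exact: mball|exact: ball_lty|by []|].
exact: bounded_cst.
Qed.

Lemma integ_sub c r f g : integ c r f -> integ c r g -> integ c r (fun x => f x - g x).
Proof.
move=> hf hg.
by apply: (eq_integrable (mball c r) _ _ _ (integrableB (mball c r) hf hg)).
Qed.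

Lemma integ_norm c r f : integ c r f -> integ c r (fun x => `|f x|).
Proof. exact: integrable_norm. Qed.

Lemma integ_pos c r f : integ c r f -> integ c r (fun x => Num.max 0 (f x)).
Proof.
move=> hf; apply: (le_integrable (mball c r) _ _ hf).
  apply/measurable_EFinP; apply: measurable_maxr => //.
  by apply/measurable_EFinP; exact: measurable_int hf.
move=> x _ /=; rewrite lee_fin; case: (lerP 0 (f x)) => // h.
by rewrite normr0.
Qed.

Lemma Rintegral_ball_cst c r k : 0 < r -> \int[mu]_(x in ball c r) k = k * vol r.
Proof. by move=> r0; rewrite Rintegral_cst ?hvol//; exact: mball. Qed.

Lemma Rintegral_subset c r c' r' f : integ c' r' f -> (forall x, 0 <= f x) ->
  ball c r `<=` ball c' r' ->
  \int[mu]_(x in ball c r) f x <= \int[mu]_(x in ball c' r') f x.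
Proof.
move=> hf f0 sub.
have hf' : integ c r f by apply: integrableS hf => //; exact: mball.
apply: fine_le; try (apply: integrable_fin_num => //; exact: mball).
apply: ge0_subset_integral => //; try exact: mball.
  exact: measurable_int hf.
by move=> x _; rewrite lee_fin.
Qed.

Lemma meanB f k c r : 0 < r -> integ c r f ->
  mean f c r - k = (vol r)^-1 * \int[mu]_(x in ball c r) (f x - k).
Proof.
move=> r0 hf; rewrite RintegralB//; [|exact: mball|exact: integ_cst].
rewrite Rintegral_ball_cst// mulrBr mulrCA mulVf ?mulr1//.
by rewrite gt_eqF// vol_gt0.
Qed.

Lemma dist_mean_le f k c r : 0 < r -> integ c r f ->
  `|mean f c r - k| <= (vol r)^-1 * \int[mu]_(x in ball c r) `|f x - k|.
Proof.
move=> r0 hf; rewrite meanB// normrM ger0_norm ?inv_vol_ge0//.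
rewrite ler_wpM2l ?inv_vol_ge0//.
by apply: le_normr_Rintegral; [exact: mball|exact: integ_sub (integ_cst _ _ _)].
Qed.

Variables (beta C : R).
Hypotheses (beta_gt0 : 0 < beta) (C_gt0 : 0 < C).
Hypothesis hK : forall c r, 0 < r ->
  (\int[mu]_(x in ball c r) (Num.max 0 (mean (fun y => `|b y|) c r - b x))%:E <=
    (C * r `^ beta * vol r)%:E)%E.

Local Notation a c r := (mean (fun y => `|b y|) c r).
Local Notation m c r := (mean b c r).

Lemma deficit_le c r : 0 < r ->
  \int[mu]_(x in ball c r) Num.max 0 (a c r - b x) <= C * r `^ beta * vol r.
Proof.
move=> r0; have hh := integ_pos (integ_sub (integ_cst c r (a c r)) (integ_b c r)).
rewrite -lee_fin /Rintegral fineK; first exact: hK.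
by apply: integrable_fin_num => //; exact: mball.
Qed.

Lemma mean_le_mean_norm c r : 0 < r -> m c r <= a c r.
Proof.
move=> r0; rewrite ler_wpM2l ?inv_vol_ge0//.
apply: le_Rintegral.
- exact: mball.
- exact: integ_b.
- exact/integ_norm/integ_b.
- by move=> x _; exact: ler_norm.
Qed.

Lemma mean_norm_sub_mean_le c r : 0 < r -> a c r - m c r <= C * r `^ beta.
Proof.
move=> r0; have V0 : 0 < vol r by exact: vol_gt0.
rewrite -(ler_pM2r V0); apply: le_trans (deficit_le c r0).
have -> : (a c r - m c r) * vol r = \int[mu]_(x in ball c r) (a c r - b x).
  rewrite RintegralB; [|exact: mball|exact: integ_cst|exact: integ_b].
  have hm : m c r * vol r = \int[mu]_(x in ball c r) b x.
    by rewrite /mean mulrAC mulVf ?mul1r// gt_eqF.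
  by rewrite Rintegral_ball_cst// mulrBl hm.
apply: le_Rintegral.
- exact: mball.
- exact: integ_sub (integ_cst _ _ _) (integ_b _ _).
- exact: integ_pos (integ_sub (integ_cst _ _ _) (integ_b _ _)).
- by move=> x _; rewrite le_max lexx orbT.
Qed.

(** As b - m has mean 0, the integral of |b - m| is twice that of the negative
    part of b - m, which is at most the deficit since m <= a. *)
Lemma mean_oscillation c r : 0 < r ->
  \int[mu]_(x in ball c r) `|b x - m c r| <= 2 * C * r `^ beta * vol r.
Proof.
move=> r0; have V0 : 0 < vol r by exact: vol_gt0.
have ib := integ_b c r; have icst k := integ_cst c r k.
have ipos := integ_pos (integ_sub (icst (a c r)) ib).
have ipos2 : integ c r (fun x => 2 * Num.max 0 (a c r - b x)).
  by apply: (eq_integrable (mball c r) _ _ _ (integrableZl (mball c r) 2 ipos)).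
apply: (@le_trans _ _ (\int[mu]_(x in ball c r)
    (2 * Num.max 0 (a c r - b x) - (m c r - b x)))).
  apply: le_Rintegral.
  - exact: mball.
  - exact: integ_norm (integ_sub ib (icst _)).
  - exact: integ_sub ipos2 (integ_sub (icst _) ib).
  move=> x _; have ma := mean_le_mean_norm c r0.
  have : 0 <= Num.max 0 (a c r - b x) by rewrite le_max lexx.
  have : a c r - b x <= Num.max 0 (a c r - b x) by rewrite le_max lexx orbT.
  by move=> h1 h2; exact: dist_le_deficit ma h1 h2.
rewrite RintegralB; [|exact: mball|exact: ipos2|exact: integ_sub (icst _) ib].
rewrite RintegralZl; [|exact: mball|exact: ipos].
rewrite RintegralB; [|exact: mball|exact: icst|exact: ib].
have hm : m c r * vol r = \int[mu]_(x in ball c r) b x.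
  by rewrite /mean mulrAC mulVf ?mul1r// gt_eqF.
rewrite Rintegral_ball_cst// hm subrr subr0.
by rewrite -!mulrA ler_pM2l// mulrA; exact: deficit_le.
Qed.

Lemma mean_nested c r c' r' : 0 < r -> 0 < r' -> ball c r `<=` ball c' r' ->
  `|m c r - m c' r'| <= 2 * C * r' `^ beta * (r' / r) ^+ Q.
Proof.
move=> r0 r'0 sub; have V0 : 0 < vol r by exact: vol_gt0.
apply: (le_trans (dist_mean_le _ r0 (integ_b c r))).
rewrite mulrC ler_pdivrMr//.
apply: (@le_trans _ _ (\int[mu]_(x in ball c' r') `|b x - m c' r'|)).
  by apply: Rintegral_subset sub => //; exact: integ_norm (integ_sub (integ_b _ _) (integ_cst _ _ _)).
apply: (le_trans (mean_oscillation c' r'0)).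
rewrite -[leRHS]mulrA le_eqVlt; apply/orP; left; apply/eqP; congr (_ * _).
by rewrite mulrCA -exprMn divfK// gt_eqF.
Qed.

Lemma gball_sub_radius c r s : r <= s -> ball c r `<=` ball c s.
Proof. by move=> rs y /= /lt_le_trans; exact. Qed.

(** Halving the radius changes the mean by a multiple of r^beta, so that the
    changes form a geometric series. *)
Lemma mean_concentric : exists2 D, 0 < D & forall c s r, 0 < s -> s <= r ->
  `|m c s - m c r| <= D * r `^ beta.
Proof.
(* A is the cost of one halving; D sums the geometric series, see DE. *)
pose A := 2 * C * 2 ^+ Q.
have A0 : 0 < A by rewrite !mulr_gt0// exprn_gt0.
pose D := A * geom_const beta.
have D0 : 0 < D by rewrite mulr_gt0// geom_const_gt0.
exists D => // c s r s0 sr.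
have base r' : 0 < r' -> r' / 2 <= s -> s <= r' -> `|m c s - m c r'| <= A * r' `^ beta.
  move=> r'0 r's sr'.
  apply: (le_trans (mean_nested s0 r'0 (gball_sub_radius (c := c) sr'))).
  rewrite /A [leRHS]mulrAC ler_wpM2l//.
    by rewrite !mulr_ge0 ?powR_ge0// ltW.
  rewrite lerXn2r ?nnegrE ?divr_ge0 ?(ltW r'0) ?(ltW s0)//.
  by rewrite ler_pdivrMr// mulrC -ler_pdivrMr.
have DE : D * 2 `^ (- beta) + A = D.
  rewrite /D -mulrA -[X in _ + X]mulr1 -mulrDr; congr (_ * _).
  exact: geom_constE.
have key n : forall r', 0 < r' -> r' / 2 ^+ n <= s -> s <= r' ->
    `|m c s - m c r'| <= D * r' `^ beta.
  elim: n => [|n IH] r' r'0 r's sr'.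
    apply: le_trans (base _ r'0 _ sr') _; last first.
      rewrite ler_wpM2r ?powR_ge0// -DE lerDr mulr_ge0 ?powR_ge0// ltW//.
    apply: le_trans r's; rewrite expr0 divr1 ler_pdivrMr//.
    by rewrite ler_peMr ?ler1n// ltW.
  have [h|h] := leP (r' / 2) s.
    apply: le_trans (base _ r'0 h sr') _.
    by rewrite ler_wpM2r ?powR_ge0// -DE lerDr mulr_ge0 ?powR_ge0// ltW.
  have r'20 : 0 < r' / 2 by rewrite divr_gt0.
  have h1 : `|m c s - m c (r' / 2)| <= D * (r' / 2) `^ beta.
    by apply: IH => //; [rewrite -mulrA -invfM -exprS|exact: ltW].
  have h2 : `|m c (r' / 2) - m c r'| <= A * r' `^ beta.
    have sub : ball c (r' / 2) `<=` ball c r'.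
      by apply: gball_sub_radius; rewrite ler_pdivrMr// ler_peMr ?ler1n// ltW.
    apply: (le_trans (mean_nested r'20 r'0 sub)).
    rewrite /A [leRHS]mulrAC invf_div mulrCA mulfV ?mulr1//.
    by rewrite gt_eqF.
  rewrite -DE mulrDl; apply: le_trans (ler_distD (m c (r' / 2)) _ _) _.
  apply: lerD => //; apply: (le_trans h1).
  rewrite powRM ?invr_ge0 ?(ltW r'0)// -powR_inv1// -powRrM mulN1r.
  by rewrite -mulrA [X in _ * X]mulrC.
have r0 : 0 < r by exact: lt_le_trans sr.
pose n := Num.truncn (r / s).
apply: (key n.+1) => //; rewrite ler_pdivrMr ?exprn_gt0// mulrC -ler_pdivrMr//.
apply/ltW/(lt_trans (truncnS_gt _)); rewrite -natrX ltr_nat.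
exact: ltn_expl.
Qed.

Theorem nonneg_Lambda_representative : exists b' : G -> R,
  [/\ {ae mu, forall x, b x = b' x}, Lambda rho beta b' & forall x, 0 <= b' x].
Proof.
have [D D0 hD] := mean_concentric.
have [c0 c01 hM] := hnormM hrho.
have c00 : 0 < c0 by rewrite (lt_le_trans ltr01).
(* The intervals of radius D r^beta about the means have a common point. *)
have /choice[b' hb'] : forall x, exists v : R, forall r, 0 < r -> `|v - m x r| <= D * r `^ beta.
  move=> x; pose S := [set m x r - D * r `^ beta | r in [set r | 0 < r]].
  have ub s : 0 < s -> ubound S (m x s + D * s `^ beta).
    move=> s0 _ [r /= r0 <-]; have [rs|/ltW sr] := leP r s.
      have [h _] := dist_le (hD x r s r0 rs).
      rewrite lerBlDr (le_trans h)// lerDl mulr_ge0 ?powR_ge0// ltW//.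
    have [_ h] := dist_le (hD x s r s0 sr).
    rewrite lerBlDr (le_trans h)// lerD2r lerDl.
    by rewrite mulr_ge0 ?powR_ge0// ltW.
  exists (sup S) => r r0.
  have S0 : S !=set0 by exists (m x r - D * r `^ beta); exists r.
  rewrite ler_distl; apply/andP; split.
    by apply: ub_le_sup; [exists (m x r + D * r `^ beta); exact: ub|exists r].
  by apply: ge_sup => //; exact: ub.
(* The balls of radius s about x and of radius k s about y are nested, so their
   means are close; s is any number above the distance, which may be 0. *)
have Lam : exists2 F, 0 < F & forall x y s, 0 < s -> rho (y^-1 * x)%g < s ->
    `|b' x - b' y| <= F * s `^ beta.
  pose k := 2 * c0; have k0 : 0 < k by rewrite mulr_gt0.
  exists (D + 2 * C * k `^ beta * k ^+ Q + D * k `^ beta).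
    by rewrite !addr_gt0 ?mulr_gt0 ?powR_gt0 ?exprn_gt0.
  move=> x y s s0 xys.
  have sub : ball x s `<=` ball y (k * s).
    move=> z; rewrite /gball /= => zx.
    apply: (le_lt_trans (rho_triangle hM y x z)).
    rewrite (rho_sym hrho y x).
    have -> : k * s = c0 * (s + s) by rewrite /k; ring.
    by rewrite ltr_pM2l// ltrD.
  have ks0 : 0 < k * s by rewrite mulr_gt0.
  have h1 := hb' x _ s0; have h2 := hb' y _ ks0.
  have h3 := mean_nested s0 ks0 sub.
  rewrite powRM ?(ltW k0) ?(ltW s0)// mulfK ?gt_eqF// in h3.
  rewrite powRM ?(ltW k0) ?(ltW s0)// in h2.
  have -> : (D + 2 * C * k `^ beta * k ^+ Q + D * k `^ beta) * s `^ beta =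
     D * s `^ beta + (2 * C * (k `^ beta * s `^ beta) * k ^+ Q) + D * (k `^ beta * s `^ beta).
    by move: (k ^+ Q) (k `^ beta) (s `^ beta) => ? ? ?; ring.
  apply: le_trans (ler_distD (m y (k * s)) _ _) _; apply: lerD; last by rewrite distrC.
  by apply: le_trans (ler_distD (m x s) _ _) _; apply: lerD.
have [F F0 hF] := Lam.
have bLam : Lambda rho beta b'.
  exists (F * 2 `^ beta); first by rewrite mulr_gt0 ?powR_gt0.
  move=> x y; have := hnorm_ge0 hrho (y^-1 * x)%g; rewrite le_eqVlt => /orP[/eqP e0|p0].
    rewrite -e0 powR0 ?gt_eqF// mulr0; apply: (@le0_of_le_powR _ beta _ F beta_gt0) => s s0.
    by apply: hF => //; rewrite -e0.
  rewrite -mulrA -powRM ?(ltW p0)//; apply: hF; first by rewrite mulr_gt0.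
  by rewrite ltr_pMl// ltr1n.
exists b'; split => //; last first.
  move=> x; rewrite -oppr_le0; apply: (@le0_of_le_powR _ beta _ (D + C) beta_gt0) => s s0.
  have [_ h1] := dist_le (hb' x s s0).
  have h2 := mean_norm_sub_mean_le x s0.
  have h3 : 0 <= a x s.
    rewrite mulr_ge0 ?inv_vol_ge0//.
    by apply: Rintegral_ge0.
  by rewrite mulrDl; exact: opp_le_of_mean h1 h2 h3.
have cb' := Lambda_continuous hrho beta_gt0 bLam.
have mb' : measurable_fun setT (b' : T -> R) by exact: continuous_borel.
pose F1 (x : T) := `|b x - b' x|.
have F10 x : (0 <= (F1 x)%:E)%E by rewrite lee_fin /F1.
have mF1 : measurable_fun setT (EFin \o F1).
  apply/measurable_EFinP; apply: measurableT_comp => //.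
  by apply: measurable_funB => //; case: hb.
have [L L0 hL] := Lambda_gball hrho beta_gt0 bLam.
pose H := 2 * C + (L + D).
have H0 : 0 < H by rewrite !addr_gt0// mulr_gt0.
(* On the ball, both b, in the mean, and b' differ from the mean of b by
   O(r^beta). *)
have decay c r : 0 < r ->
    (\int[mu]_(x in ball c r) (F1 x)%:E <= (H * r `^ beta * vol r)%:E)%E.
  move=> r0.
  have i1 : integ c r (fun x => `|b x - m c r|).
    exact: integ_norm (integ_sub (integ_b _ _) (integ_cst _ _ _)).
  apply: (@le_trans _ _ (\int[mu]_(x in ball c r)
      (`|b x - m c r|%:E + ((L + D) * r `^ beta)%:E)))%E.
    apply: ge0_le_integral => //.
    - exact: mball.
    - exact: measurable_funS mF1.
    - by apply: emeasurable_funD => //; exact: measurable_int i1.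
    move=> x xB; rewrite -EFinD lee_fin /F1.
    apply: le_trans (ler_distD (m c r) _ _) _; rewrite lerD2l distrC mulrDl.
    apply: le_trans (ler_distD (b' c) _ _) _; apply: lerD; last exact: hb'.
    exact: hL r0 xB (gball_center hrho c r0).
  rewrite ge0_integralD//; last 3 first.
  - exact: mball.
  - exact: measurable_int i1.
  - by move=> x _; rewrite lee_fin mulr_ge0 ?powR_ge0// addr_ge0 ?ltW.
  rewrite integral_cst; last exact: mball.
  have -> : H * r `^ beta * vol r = 2 * C * r `^ beta * vol r + (L + D) * r `^ beta * vol r.
    by rewrite -mulrDl -mulrDl.
  rewrite hvol// EFinD -EFinM leeD2r//.
  rewrite -(fineK (integrable_fin_num (mball _ _) i1)) lee_fin.
  exact: mean_oscillation.
pose K := 3 * c0 ^+ 2.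
have K0 : 0 < K by rewrite mulr_gt0// exprn_gt0.
suff zero (n : nat) : {ae mu, forall x, ball 1%g n.+1%:R x -> F1 x = 0}.
  have : {ae mu, forall x, forall n : nat, ball 1%g n.+1%:R x -> F1 x = 0}.
    exact: ae_foralln.
  move=> hz; apply: (@filterS _ _ (ae_filter_ringOfSetsType mu) _ _ _ hz) => x.
  move=> /(_ (Num.truncn (rho (x^-1 * 1)%g))) h.
  apply/eqP; rewrite -subr_eq0 -normr_eq0; apply/eqP; apply: h.
  exact: truncnS_gt.
set N : R := n.+1%:R; have N0 : 0 < N by rewrite ltr0n.
pose N' := c0 * (c0 * (N + 1) + 1).
have N'0 : 0 < N' by rewrite !(mulr_gt0, addr_gt0).
(* Cover the ball of radius N by balls of radius r with centers among the
   rational points; for r <= 1 they all lie in the ball of radius N'. *)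
have bound r : 0 < r -> r <= 1 ->
    (\int[mu]_(x in ball 1%g N) (F1 x)%:E <=
      (H * K `^ beta * K ^+ Q * vol N' * r `^ beta)%:E)%E.
  move=> r0 r1.
  pose P := [set i | ball 1%g (c0 * (N + 1)) (rat_ball G i).1].
  pose B i := ((rat_ball G i).1, r).
  apply: (@le_trans _ _ (\int[mu]_(x in \bigcup_(i in P) ball (B i).1 (B i).2) (F1 x)%:E)%E).
    apply: ge0_subset_integral => //.
    - exact: mball.
    - by apply: bigcup_measurable => i _; exact: mball.
    - exact: measurable_funS mF1.
    move=> x xN; have [|i [xi _ _]] := rat_ballP hrho x r0 (_ : 0 < 1); first exact: ltr01.
    exists i; last by rewrite /B /gball /= (rho_sym hrho).
    rewrite /P /= /gball /=; apply: (le_lt_trans (rho_triangle hM 1%g x _)).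
    rewrite ltr_pM2l// ltrD//; exact: lt_le_trans xi r1.
  have -> : (H * K `^ beta * K ^+ Q * vol N' * r `^ beta)%:E =
    ((H * K `^ beta * K ^+ Q * r `^ beta)%:E * \int[mu]_(x in ball 1%g N') cst 1 x)%E.
    rewrite integral_cst ?mul1e; last exact: mball.
    by rewrite hvol// -EFinM mulrAC.
  apply: (vitali_countable hrho c01 hM) => //.
  - by rewrite !mulr_ge0 ?powR_ge0 ?exprn_ge0 ?(ltW K0) ?(ltW H0).
  - exact: mball.
  - move=> i Pi y; rewrite /B /= /gball /= => yi.
    apply: (le_lt_trans (rho_triangle hM 1%g (rat_ball G i).1 y)).
    by rewrite ltr_pM2l// ltrD//; exact: lt_le_trans r1.
  move=> i Pi; split => //=; apply: (le_trans (decay _ _ _)); first by rewrite mulr_gt0.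
  rewrite integral_cst ?mul1e; last exact: mball.
  rewrite hvol// -EFinM lee_fin powRM ?(ltW K0) ?(ltW r0)// exprMn.
  rewrite le_eqVlt; apply/orP; left; apply/eqP; rewrite -/K.
  by move: (K `^ beta) (r `^ beta) (K ^+ Q) (r ^+ Q) => ? ? ? ?; ring.
(* The bound tends to 0 with r; beyond r = 1 it is extended by the integral
   itself, as le0_of_le_powR asks for every radius. *)
have int0 : (\int[mu]_(x in ball 1%g N) `|(EFin \o F1) x| = 0)%E.
  apply/eqP; rewrite eq_le integral_ge0 ?andbT//.
  have -> : (\int[mu]_(x in ball 1%g N) `|(EFin \o F1) x| =
      \int[mu]_(x in ball 1%g N) (F1 x)%:E)%E.
    by apply: eq_integral => x _; exact: (gee0_abs (F10 x)).
  have := bound 1 ltr01 (lexx _).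
  have : (0 <= \int[mu]_(x in ball 1%g N) (F1 x)%:E)%E by apply: integral_ge0.
  case E : (\int[mu]_(x in ball 1%g N) (F1 x)%:E)%E => [v| |//]; last by rewrite leye_eq.
  move=> v0 _; rewrite lee_fin.
  apply: (@le0_of_le_powR _ beta _ (Num.max (H * K `^ beta * K ^+ Q * vol N') v) beta_gt0) => s s0.
  have [s1|s1] := leP s 1.
    have := bound s s0 s1; rewrite E lee_fin => /le_trans; apply.
    by rewrite ler_wpM2r ?powR_ge0// le_max lexx.
  apply: (@le_trans _ _ (v * s `^ beta)).
    have : 1 `^ beta <= s `^ beta.
      by apply: ge0_ler_powR; rewrite ?nnegrE ?(ltW s0) ?(ltW s1) ?(ltW beta_gt0).
    by rewrite powR1 => h; rewrite ler_peMr.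
  by rewrite ler_wpM2r ?powR_ge0// le_max lexx orbT.
have /(ae_eq_integral_abs _ (mball _ _) (measurable_funS measurableT (@subsetT _ _) mF1)) := int0.
by apply: filterS => x h /h [].
Qed.

End campanato.

(** * Necessity, and the equivalence *)

Section necessity.
Context {R : realType} (G : stratifiedGroup R).
Local Notation T := (borelType G).
Variable mu : {measure set T -> \bar R}.
Hypothesis hmu : biinvariant_haar mu.
Variables (rho : G -> R) (hrho : homogeneous_norm rho).
Local Notation mball := (gball_measurable hrho).
Local Notation Q := (hom_dim G).
Local Notation M alpha f := (frac_maximal mu rho alpha f).
Variables (c1 : R) (c1_gt0 : 0 < c1).
Local Notation vol r := (c1 * r ^+ Q).
Hypothesis hvol : forall (x : G) (r : R), 0 < r -> mu (gball rho x r) = (vol r)%:E.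
Hypothesis Q_gt0 : (0 < Q)%N.
Variables (b : T -> R) (hb : loc_integrable mu b).
Variables (alpha beta : R).
Hypotheses (alpha_gt0 : 0 < alpha) (alphaQ : alpha < Q%:R) (beta_gt0 : 0 < beta).
Local Notation ball := (gball rho).
Local Notation a c r := (mean mu rho c1 (fun y => `|b y|) c r).
Local Notation h c r x := (Num.max 0 (a c r - b x)).

Local Open Scope ereal_scope.

Lemma integral_norm_mean c r : (0 < r)%R ->
  \int[mu]_(y in ball c r) `|b y|%:E = (vol r * a c r)%:E.
Proof.
move=> r0; have V0 : (0 < vol r)%R by exact: vol_gt0.
rewrite /mean mulrA mulfV ?gt_eqF// mul1r fineK//.
apply: integrable_fin_num; first exact: mball.
exact: integ_norm (integ_b hmu hrho hvol hb c r).
Qed.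

Lemma frac_average_norm_mean gamma c r : (0 < r)%R ->
  frac_average mu rho gamma b c r = (vol r `^ (gamma / Q%:R) * a c r)%:E.
Proof.
move=> r0; have V0 : (0 < vol r)%R by exact: vol_gt0.
rewrite (frac_averageE c1_gt0 hvol)// integral_norm_mean// -EFinM mulrA.
congr (_ * _)%:E; rewrite powRD; last by apply/implyP => _; rewrite gt_eqF.
by rewrite powR_inv1 ?(ltW V0)// divfK// gt_eqF.
Qed.

Lemma measurable_deficit c r : measurable_fun (setT : set T) (fun x => h c r x).
Proof. by apply: measurable_maxr => //; apply: measurable_funB => //; case: hb. Qed.

(** The power mean that the hypotheses provide controls the mean itself. *)
Lemma Lambda_of_deficit (s C : R) : (1 <= s)%R -> (0 < C)%R ->
  (forall c r, (0 < r)%R -> \int[mu]_(x in ball c r) ((h c r x) `^ s)%:E <=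
     ((C * r `^ beta) `^ s * vol r)%:E) ->
  exists b' : G -> R, [/\ {ae mu, forall x, b x = b' x},
    Lambda rho beta b' & forall x, (0 <= b' x)%R].
Proof.
move=> s1 C0 hs.
apply: (@nonneg_Lambda_representative _ _ _ hmu _ hrho _ c1_gt0 hvol _ hb beta (2 * C)) => //.
  by rewrite mulr_gt0.
move=> c r r0; rewrite -(mulrA 2%R).
apply: (integral_le_of_power (s := s)) => //.
- exact: mball.
- exact: hvol.
- exact: measurable_funS (measurable_deficit c r).
- by move=> x _; rewrite le_max lexx.
- by rewrite mulr_gt0// powR_gt0.
- exact: hs.
Qed.

Theorem Lambda_of_oscillation (s : R) : (1 <= s)%R ->
  oscillation_bounded mu rho b alpha beta s ->
  exists b' : G -> R, [/\ {ae mu, forall x, b x = b' x},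
    Lambda rho beta b' & forall x, (0 <= b' x)%R].
Proof.
move=> s1 osc; have s0 : (0 < s)%R by rewrite (lt_le_trans ltr01).
have [K K0 hK] : exists2 K, (0 < K)%R & forall c r, (0 < r)%R ->
    oscillation mu rho b alpha beta s c r <= K%:E.
  move: osc; rewrite /oscillation_bounded; set S := ereal_sup _ => Soo.
  have hS c r : (0 < r)%R -> oscillation mu rho b alpha beta s c r <= S.
    by move=> r0; apply: ereal_sup_ubound; exists c, r.
  exists (`|fine S| + 1)%R; first by rewrite ltr_wpDl.
  move=> c r r0; apply: (le_trans (hS c r r0)).
  case: S Soo {hS} => [S| |] //= _; last by rewrite leNye.
  by rewrite lee_fin (le_trans (ler_norm _))// lerDl.
pose e := (c1 `^ (beta / Q%:R))%R.
have e0 : (0 < e)%R by exact: powR_gt0.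
apply: (Lambda_of_deficit s1 (mulr_gt0 K0 e0)) => c r r0.
have V0 : (0 < vol r)%R by exact: vol_gt0.
have := hK c r r0; rewrite /oscillation hvol// !poweR_EFin !inver !gt_eqF ?powR_gt0//.
set I := \int[mu]_(x in _) _ => hI.
have I0 : 0 <= I by apply: integral_ge0 => x _; exact: poweR_ge0.
apply: (@le_trans _ _ I).
  apply: ge0_le_integral.
  - exact: mball.
  - by move=> x _; rewrite lee_fin powR_ge0.
  - apply/measurable_EFinP; apply: (measurableT_comp (measurable_powR _)).
    exact: measurable_funS (measurable_deficit c r).
  - apply: (measurableT_comp (measurable_poweR _)); apply: measurableT_comp => //.
    apply: emeasurable_funB.
      by apply/measurable_EFinP; apply: measurable_funS measurableT (@subsetT _ _) _; case: hb.
    apply: measurable_funeM; apply: measurable_funS measurableT (@subsetT _ _) _.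
    exact: measurable_frac_maximal_in.
  move=> x xB; rewrite -poweR_EFin.
  apply: gt0_ler_poweR.
  - exact: ltW.
  - by rewrite in_itv/= leey andbT lee_fin le_max lexx.
  - by rewrite in_itv/= leey andbT abse_ge0.
  apply: pos_part_le_abse.
  apply: (@le_trans _ _ ((vol r `^ (- (alpha / Q%:R)))%:E * frac_average mu rho alpha b c r)).
    rewrite frac_average_norm_mean// -EFinM lee_fin mulrA powRN mulVf ?mul1r//.
    by rewrite gt_eqF// powR_gt0.
  apply: lee_wpmul2l; first by rewrite lee_fin powR_ge0.
  by apply: ereal_sup_ubound; exists c, r; split.
move: I I0 hI => [i| |] //.
- rewrite lee_fin => i0 hi.
  pose w := ((vol r)^-1 * i)%R.
  have w0 : (0 <= w)%R by rewrite mulr_ge0// invr_ge0 ltW.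
  have hw : (w `^ s^-1 <= K * e * r `^ beta)%R.
    move: hi; rewrite (_ : ((vol r)^-1)%:E * i%:E = w%:E)// poweR_EFin -EFinM lee_fin.
    by rewrite ler_pdivrMl ?powR_gt0// vol_powR// -/e mulrC mulrA.
  have -> : i = (w * vol r)%R by rewrite /w mulrAC mulVf ?mul1r// gt_eqF.
  rewrite lee_fin ler_pM2r//.
  have -> : w = ((w `^ s^-1) `^ s)%R by rewrite -powRrM mulVf ?gt_eqF// powRr1.
  apply: ge0_ler_powR; rewrite ?nnegrE ?powR_ge0 ?(ltW s0)//.
  exact: le_trans (powR_ge0 _ _) hw.
- move=> _; rewrite gt0_muley ?lte_fin ?invr_gt0// poweRyr ?gt_eqF ?invr_gt0//.
  by rewrite gt0_muley ?lte_fin ?invr_gt0 ?powR_gt0.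
Qed.

(** The measure of the intersection with a ball of volume V' is at most
    min (V, V'), and alpha / Q lies between 0 and 1. *)
Lemma frac_maximal_indic c r x : (0 < r)%R -> ball c r x ->
  M alpha (\1_(ball c r : set T)) x = (vol r `^ (alpha / Q%:R))%:E.
Proof.
move=> r0 xB; have V0 : (0 < vol r)%R by exact: vol_gt0.
have Q0 : (0 < Q%:R :> R)%R by rewrite ltr0n.
have aQ : (alpha / Q%:R - 1 <= 0)%R by rewrite subr_le0 ler_pdivrMr// mul1r ltW.
have intE c' r' : \int[mu]_(y in ball c' r') `|\1_(ball c r : set T) y|%:E =
    mu (ball c r `&` ball c' r').
  rewrite -integral_indic; [|exact: mball..].
  by apply: eq_integral => y _; rewrite ger0_norm.
have powE v : (0 < v)%R -> (v `^ (alpha / Q%:R - 1) * v = v `^ (alpha / Q%:R))%R.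
  move=> v0; rewrite -[in X in (_ * X)%R](powRr1 (ltW v0)) -powRD ?subrK//.
  by apply/implyP => _; rewrite gt_eqF.
apply/eqP; rewrite eq_le; apply/andP; split; last first.
  apply: le_trans (frac_average_le mu alpha _ r0 xB).
  rewrite (frac_averageE c1_gt0 hvol)// intE setIid hvol// -EFinM lee_fin.
  by rewrite powE.
apply: frac_maximal_le => c' r' r'0 xB'.
have V'0 : (0 < vol r')%R by exact: vol_gt0.
rewrite (frac_averageE c1_gt0 hvol)// intE.
have [V'V|VV'] := leP (vol r') (vol r).
  apply: (@le_trans _ _ ((vol r' `^ (alpha / Q%:R - 1))%:E * (vol r')%:E)).
    apply: lee_wpmul2l; first by rewrite lee_fin powR_ge0.
    by rewrite -(hvol c' r'0); apply: le_measure; rewrite ?inE;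
      [apply: measurableI; exact: mball|exact: mball|exact: subIsetr].
  rewrite -EFinM lee_fin powE//; apply: ge0_ler_powR; rewrite ?nnegrE ?(ltW V0) ?(ltW V'0)//.
  by rewrite divr_ge0 ?ltW.
apply: (@le_trans _ _ ((vol r' `^ (alpha / Q%:R - 1))%:E * (vol r)%:E)).
  apply: lee_wpmul2l; first by rewrite lee_fin powR_ge0.
  by rewrite -(hvol c r0); apply: le_measure; rewrite ?inE;
    [apply: measurableI; exact: mball|exact: mball|exact: subIsetl].
rewrite -(powE (vol r) V0) -EFinM lee_fin ler_pM2r//.
have powN v : (v `^ (alpha / Q%:R - 1) = (v `^ (1 - alpha / Q%:R))^-1)%R.
  by rewrite -powRN opprB.
rewrite !powN lef_pV2 ?posrE ?powR_gt0//.
apply: ge0_ler_powR; rewrite ?nnegrE ?(ltW V0) ?(ltW V'0) ?(ltW VV')//.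
by rewrite -oppr_le0 opprB.
Qed.

(** The commutator is tested on the indicator function f of a ball: on that
    ball it is at most V^(alpha/Q) (b - |b|_B), where V is the volume. *)
Theorem Lambda_of_commutator (p q : R) : (1 < p)%R -> (p < Q%:R / (alpha + beta))%R ->
  (q^-1 = p^-1 - (alpha + beta) / Q%:R)%R ->
  bounded_Lp_Lq mu (max_commutator mu rho b alpha) p q ->
  exists b' : G -> R, [/\ {ae mu, forall x, b x = b' x},
    Lambda rho beta b' & forall x, (0 <= b' x)%R].
Proof.
move=> p1 pQ pq [C C0 hC].
have p0 : (0 < p)%R by rewrite (lt_trans ltr01).
have pn0 : p != 0%R by rewrite gt_eqF.
have Q0 : (0 < Q%:R :> R)%R by rewrite ltr0n.
have ab0 : (0 < alpha + beta)%R by rewrite addr_gt0.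
have abp : ((alpha + beta) / Q%:R < p^-1)%R.
  by rewrite ltr_pdivrMr// mulrC ltr_pdivlMr// mulrC -ltr_pdivlMr.
have q0 : (0 < q)%R by rewrite -invr_gt0 pq subr_gt0.
have qn0 : q != 0%R by rewrite gt_eqF.
have q1 : (1 <= q)%R.
  rewrite -invf_le1// pq (@le_trans _ _ p^-1)%R//.
    by rewrite gerBl divr_ge0// ltW.
  by rewrite invf_le1// ltW.
pose e := (c1 `^ (beta / Q%:R))%R.
have e0 : (0 < e)%R by exact: powR_gt0.
apply: (Lambda_of_deficit q1 (mulr_gt0 C0 e0)) => c r r0.
have V0 : (0 < vol r)%R by exact: vol_gt0.
set V := vol r in V0.
set W := (V `^ (alpha / Q%:R))%R.
have W0 : (0 < W)%R by exact: powR_gt0.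
set f : G -> R := \1_(ball c r : set T).
have mf : measurable_fun (setT : set T) f by apply: measurable_indic; exact: mball.
have Nf : 'N[mu]_p%:E[EFin \o f] = (V `^ p^-1)%:E.
  rewrite unlock; transitivity ((\int[mu]_x (\1_(ball c r : set T) x)%:E) `^ p^-1).
    congr (_ `^ _); apply: eq_integral => x _ /=; rewrite /f indicE.
    by case: (_ \in _); rewrite ?normr1 ?powR1// normr0 powR0.
  by rewrite integral_indic ?setIT ?hvol//; exact: mball.
have := hC f mf; rewrite Nf ltry => /(_ isT) hT.
have intT : \int[mu]_x `|max_commutator mu rho b alpha f x| `^ q <= ((C * V `^ p^-1) `^ q)%:E.
  rewrite -powR_Lnorm// -poweR_EFin; apply: gt0_ler_poweR => //.
  - exact: ltW.
  - by rewrite in_itv/= leey andbT Lnorm_ge0.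
  - by rewrite in_itv/= leey andbT lee_fin mulr_ge0 ?powR_ge0// ltW.
have mT : measurable_fun (setT : set T) (fun x => `|max_commutator mu rho b alpha f x| `^ q).
  apply: (measurableT_comp (measurable_poweR _)); apply: measurableT_comp => //.
  by apply: measurable_max_commutator => //; case: hb.
have mh : measurable_fun (ball c r : set T) (fun x => (h c r x `^ q)%:E).
  apply/measurable_EFinP; apply: (measurableT_comp (measurable_powR _)).
  exact: measurable_funS (measurable_deficit c r).
have key : (W `^ q)%:E * \int[mu]_(x in ball c r) (h c r x `^ q)%:E <= ((C * V `^ p^-1) `^ q)%:E.
  apply: le_trans intT.
  apply: (@le_trans _ _ (\int[mu]_(x in ball c r) `|max_commutator mu rho b alpha f x| `^ q)); last first.
    apply: ge0_subset_integral => //; first exact: mball.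
    by move=> x _; exact: poweR_ge0.
  rewrite -ge0_integralZl_EFin ?powR_ge0//; last 2 first.
  - exact: mball.
  - by move=> x _; rewrite lee_fin powR_ge0.
  apply: ge0_le_integral => //.
  - exact: mball.
  - by move=> x _; rewrite -EFinM lee_fin mulr_ge0 ?powR_ge0.
  - exact: measurable_funeM.
  - exact: measurable_funS mT.
  move=> x xB; rewrite -EFinM -powRM ?(ltW W0) ?le_max ?lexx// -poweR_EFin.
  apply: gt0_ler_poweR; first exact: ltW.
  - by rewrite in_itv/= leey andbT lee_fin mulr_ge0 ?(ltW W0)// le_max lexx.
  - by rewrite in_itv/= leey andbT abse_ge0.
  rewrite /max_commutator frac_maximal_indic// -/V -/W -EFinM (mulrC (b x)).
  rewrite maxr_pMr ?(ltW W0)// mulr0 mulrBr.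
  apply: pos_part_le_abse.
  apply: (@le_trans _ _ (frac_average mu rho alpha (fun y => b y * f y)%R c r)); last first.
    exact: frac_average_le.
  have <- : frac_average mu rho alpha b c r = (W * a c r)%:E.
    by rewrite frac_average_norm_mean.
  rewrite !(frac_averageE c1_gt0 hvol)//.
  rewrite le_eqVlt; apply/orP; left; apply/eqP; congr (_ * _).
  by apply: eq_integral => y yB; rewrite /f indicE yB mulr1.
(* The volumes match since 1/p = alpha/Q + beta/Q + 1/q. *)
have hV : (C * V `^ p^-1 = W * (C * e * r `^ beta * V `^ q^-1))%R.
  have -> : (C * e * r `^ beta = C * V `^ (beta / Q%:R))%R by rewrite vol_powR// mulrA.
  have -> : (p^-1 = alpha / Q%:R + (beta / Q%:R + q^-1))%R by rewrite pq; ring.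
  have Vp x y : (V `^ (x + y) = V `^ x * V `^ y)%R.
    by apply: powRD; apply/implyP => _; rewrite gt_eqF.
  by rewrite !Vp -/W; ring.
move: key; rewrite hV powRM ?mulr_ge0 ?powR_ge0 ?(ltW W0) ?(ltW C0) ?(ltW e0)//.
rewrite EFinM lee_pmul2l//; last by rewrite lte_fin powR_gt0.
rewrite [X in _ -> _ <= X](_ : _ = ((C * e * r `^ beta * V `^ q^-1) `^ q)%:E)//.
rewrite [in RHS]powRM ?mulr_ge0 ?powR_ge0 ?(ltW C0) ?(ltW e0)//.
by rewrite -(powRrM V) mulVf// powRr1// ltW.
Qed.

End necessity.

Theorem theorem1p1 (R : realType) (G : stratifiedGroup R)
  (mu : {measure set (borelType G) -> \bar R}) (hmu : biinvariant_haar mu)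
  (rho : G -> R) (hrho : homogeneous_norm rho)
  (hvol : exists2 c1 : R, 0 < c1 &
     forall (x : G) (r : R), 0 < r ->
       mu (gball rho x r) = (c1 * r ^+ hom_dim G)%:E)
  (alpha beta : R) (hbeta : 0 < beta < 1)
  (halpha : 0 < alpha < (hom_dim G)%:R)
  (halphabeta : 0 < alpha + beta < (hom_dim G)%:R)
  (b : G -> R) (hb : loc_integrable mu b) :
  [<->
    (* for a representative of the almost everywhere class of b *)
    exists b' : G -> R,
      [/\ {ae mu, forall x, b x = b' x},
          Lambda rho beta b' & forall x, 0 <= b' x];
    forall p q : R, 1 < p -> p < (hom_dim G)%:R / (alpha + beta) ->
      q^-1 = p^-1 - (alpha + beta) / (hom_dim G)%:R ->
      bounded_Lp_Lq mu (max_commutator mu rho b alpha) p q;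
    exists p q : R,
      [/\ 1 < p, p < (hom_dim G)%:R / (alpha + beta),
          q^-1 = p^-1 - (alpha + beta) / (hom_dim G)%:R &
          bounded_Lp_Lq mu (max_commutator mu rho b alpha) p q];
    exists2 s : R, 1 <= s & oscillation_bounded mu rho b alpha beta s;
    forall s : R, 1 <= s -> oscillation_bounded mu rho b alpha beta s].
Proof.
have [c1 c10 vol] := hvol.
have /andP[beta0 _] := hbeta; have /andP[alpha0 alphaQ] := halpha.
have /andP[ab0 abQ] := halphabeta.
have Q0 : (0 < hom_dim G)%N by rewrite -(ltr0n R) (lt_trans alpha0).
have mb := hb.1.
have osc s : (exists b' : G -> R, [/\ {ae mu, forall x, b x = b' x},
    Lambda rho beta b' & forall x, 0 <= b' x]) -> 1 <= s ->
    oscillation_bounded mu rho b alpha beta s.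
  move=> [b' [bb' b'L b'0]] s1.
  exact: (oscillation_bounded_Lambda hrho c10 vol Q0 alpha0 beta0 mb bb' b'L b'0).
have osc_Lambda := Lambda_of_oscillation hmu hrho c10 vol Q0 hb beta0.
tfae.
- move=> [b' [bb' b'L b'0]] p q p1 pQ pq.
  exact: (commutator_bounded hrho c10 vol Q0 alpha0 beta0 mb bb' b'L b'0).
- move=> bnd; have Qab : 1 < (hom_dim G)%:R / (alpha + beta) by rewrite ltr_pdivlMr// mul1r.
  have [p1 pQ] := midf_lt Qab.
  pose p := (1 + (hom_dim G)%:R / (alpha + beta)) / 2.
  exists p, (p^-1 - (alpha + beta) / (hom_dim G)%:R)^-1.
  by split => //; [rewrite invrK|apply: bnd => //; rewrite invrK].
- move=> [p [q [p1 pQ pq bnd]]]; exists 1 => //; apply: osc => //.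
  exact: (Lambda_of_commutator hmu hrho c10 vol Q0 hb alpha0 alphaQ beta0 p1 pQ pq bnd).
- by move=> [s s1 oscs] s' s'1; apply: osc => //; exact: osc_Lambda s1 oscs.
- by move=> oscs; apply: osc_Lambda (lexx 1) _; exact: oscs.
Qed.
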